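(* Let $d\ge 2$, let $k$ be an algebraically closed field of characteristic zero or greater than $d$, and let $P=k_{dp}[x,y]$. Let $Z\subset P_{\le d}$ be the set of polynomials $f$ such that $\operatorname{Apolar}(f)$ has Hilbert function $(1,2,2,\dots,2,1)$ with exactly $d-1$ twos. Then $Z$ is irreducible in the Zariski topology, and for a general element $f$ of $Z$ (i.e. for all $f$ in some non-empty Zariski open subset of $Z$) the algebra $\operatorname{Apolar}(f)$ is isomorphic to its associated graded algebra $\operatorname{gr}\operatorname{Apolar}(f)$.
   Context: Let $S=k[[\alpha,\beta]]$. $P=k_{dp}[x,y]$ is the divided power ring, with $k$-basis the monomials $x^{[a]}y^{[b]}$ (of degree $a+b$), $P_{\le d}$ is the span of those of degree at most $d$ (an affine space), and $S$ acts on $P$ by contraction: $\alpha^{a}\beta^{b}\lrcorner x^{[a']}y^{[b']}=x^{[a'-a]}y^{[b'-b]}$ if $a'\ge a$ and $b'\ge b$, and $0$ otherwise. For $f\in P$, $\operatorname{Apolar}(f)=S/\operatorname{Ann}(f)$ with $\operatorname{Ann}(f)=\{\sigma\in S:\sigma\lrcorner f=0\}$. For a local algebra $(A,\mathfrak m_A)$, the Hilbert function is $H_A(i)=\dim_k\mathfrak m_A^i/\mathfrak m_A^{i+1}$ and $\operatorname{gr}A=\bigoplus_{i}\mathfrak m_A^i/\mathfrak m_A^{i+1}$. *)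

(* Defs.v *)
From HB Require Import structures.
From mathcomp Require Import all_boot all_order all_algebra.
From mathcomp Require Import generic_quotient ring_quotient.
From mathcomp Require Import boolp classical_sets.
From mathcomp Require Import ssrcomplements mpoly.

Set Implicit Arguments.
Unset Strict Implicit.
Unset Printing Implicit Defensive.

Import GRing.Theory.

Local Open Scope ring_scope.
Local Open Scope classical_set_scope.
Local Open Scope quotient_scope.

(* Commutative algebras over k, given by their structure map k -> A.  The     *)
(* zero algebra is allowed, unlike in the library's comAlgType, as Apolar(0)  *)
(* is zero.                                                                   *)
HB.mixin Record hasAlgMap (k : pzRingType) A of GRing.ComPzRing A := {
  algmap : k -> A;
  algmap1 : algmap 1 = 1;
  algmapD : {morph algmap : a b / a + b};
  algmapM : {morph algmap : a b / a * b}
}.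

#[short(type="comPzAlgType")]
HB.structure Definition ComPzAlgebra (k : pzRingType) :=
  {A of GRing.ComPzRing A & hasAlgMap k A}.

Definition alg_isomorphic (k : pzRingType) (A B : comPzAlgType k) : Prop :=
  exists phi : {rmorphism A -> B},
    bijective phi /\ forall c : k, phi (algmap c) = algmap c.

HB.mixin Record isIdealClosed (R : pzRingType) (I : {pred R}) := {
  ideal_mulr : forall a, {in I, forall x, a * x \in I}
}.

(* Not necessarily proper ideals (ring_quotient only has proper ones). *)
#[short(type="pzIdeal")]
HB.structure Definition PzIdeal (R : pzRingType) :=
  {I of GRing.ZmodClosed R I & isIdealClosed R I}.

(* A / I: the library's quotient by an additive subgroup, with the induced    *)
(* algebra structure.                                                         *)
Section QuotientAlgebra.
Variables (k : pzRingType) (A : comPzAlgType k) (I : pzIdeal A).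

Definition alg_quot : Type := {ideal_quot I}.
HB.instance Definition _ := GRing.Zmodule.on alg_quot.
HB.instance Definition _ : EqQuotient A (Quotient.equiv I) alg_quot :=
  EqQuotient.on alg_quot.

Local Notation Q := alg_quot.
Implicit Types (x y : A) (u v w : Q).

Definition alg_quot_one : Q := \pi_Q 1.
Definition alg_quot_mul u v : Q := \pi_Q (repr u * repr v).
Definition alg_quot_map (c : k) : Q := \pi_Q (algmap c).

Lemma alg_quot_eqP x y : (\pi_Q x = \pi_Q y) <-> x - y \in I.
Proof.
have -> : (x - y \in I) = (x == y %[mod {ideal_quot I}]) by rewrite -Quotient.idealrBE.
by split=> [->|/eqP].
Qed.

Lemma alg_quot_reprB x : repr (\pi_Q x) - x \in I.
Proof. by apply/alg_quot_eqP; rewrite reprK. Qed.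

Lemma pi_algD x y : \pi_Q (x + y) = \pi_Q x + \pi_Q y.
Proof. exact: (Quotient.pi_add I). Qed.

Lemma pi_algM x y : \pi_Q (x * y) = alg_quot_mul (\pi_Q x) (\pi_Q y).
Proof.
apply/esym/alg_quot_eqP.
set x' := repr _; set y' := repr _.
have -> : x' * y' - x * y = y' * (x' - x) + x * (y' - y).
  by rewrite !mulrBr addrA (mulrC y' x') (mulrC x y') subrK.
by apply: rpredD; apply: ideal_mulr; exact: alg_quot_reprB.
Qed.

Let quotW (P : Q -> Prop) : (forall x, P (\pi_Q x)) -> forall u, P u.
Proof. by move=> h u; rewrite -[u]reprK. Qed.

Lemma alg_quot_mulA : associative alg_quot_mul.
Proof.
by elim/quotW=> x; elim/quotW=> y; elim/quotW=> z; rewrite -!pi_algM mulrA.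
Qed.

Lemma alg_quot_mulC : commutative alg_quot_mul.
Proof. by elim/quotW=> x; elim/quotW=> y; rewrite -!pi_algM mulrC. Qed.

Lemma alg_quot_mul1 : left_id alg_quot_one alg_quot_mul.
Proof. by elim/quotW=> x; rewrite -pi_algM mul1r. Qed.

Lemma alg_quot_mulDl : left_distributive alg_quot_mul +%R.
Proof.
elim/quotW=> x; elim/quotW=> y; elim/quotW=> z.
by rewrite -pi_algD -!pi_algM -pi_algD mulrDl.
Qed.

HB.instance Definition _ := GRing.Zmodule_isComPzRing.Build Q
  alg_quot_mulA alg_quot_mulC alg_quot_mul1 alg_quot_mulDl.

Lemma alg_quot_map1 : alg_quot_map 1 = 1.
Proof. by rewrite /alg_quot_map algmap1. Qed.

Lemma alg_quot_mapD : {morph alg_quot_map : a b / a + b}.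
Proof. by move=> a b; rewrite /alg_quot_map algmapD pi_algD. Qed.

Lemma alg_quot_mapM : {morph alg_quot_map : a b / a * b}.
Proof. by move=> a b; rewrite /alg_quot_map algmapM pi_algM. Qed.

HB.instance Definition _ := hasAlgMap.Build k Q
  alg_quot_map1 alg_quot_mapD alg_quot_mapM.

End QuotientAlgebra.

(* The power series ring R[[x_1, ..., x_n]]; s m is the coefficient of x^m.   *)
Definition mseries (R : comNzRingType) (n : nat) : Type := 'X_{1..n} -> R.

Section MSeries.
Variables (R : comNzRingType) (n : nat).
Local Notation S := (mseries R n).
Implicit Types (s t u : S).

HB.instance Definition _ := gen_eqMixin S.
HB.instance Definition _ := gen_choiceMixin S.

Definition ms_zero : S := fun=> 0.
Definition ms_one : S := fun m => (m == 0%MM)%:R.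
Definition ms_opp s : S := fun m => - s m.
Definition ms_add s t : S := fun m => s m + t m.
Definition ms_const (c : R) : S := fun m => c * (m == 0%MM)%:R.
Definition ms_mul s t : S := fun m =>
  \sum_(p : 'X_{1..n < (mdeg m).+1, (mdeg m).+1} | m == (p.1 + p.2)%MM)
     s p.1 * t p.2.

Lemma ms_addA : associative ms_add.
Proof. by move=> s t u; apply/funext=> m; exact: addrA. Qed.
Lemma ms_addC : commutative ms_add.
Proof. by move=> s t; apply/funext=> m; exact: addrC. Qed.
Lemma ms_add0 : left_id ms_zero ms_add.
Proof. by move=> s; apply/funext=> m; exact: add0r. Qed.
Lemma ms_addN : left_inverse ms_zero ms_opp ms_add.
Proof. by move=> s; apply/funext=> m; exact: addNr. Qed.

HB.instance Definition _ := GRing.isZmodule.Build S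
  ms_addA ms_addC ms_add0 ms_addN.

Definition ms_trunc (N : nat) s : {mpoly R[n]} :=
  \sum_(m : 'X_{1..n < N}) s m *: 'X_[m].

Lemma ms_truncE N s m : (mdeg m < N)%N -> (ms_trunc N s)@_m = s m.
Proof. exact: mcoeff_mpoly. Qed.

Lemma ms_mulE N s t m : (mdeg m < N)%N ->
  ms_mul s t m = (ms_trunc N s * ms_trunc N t)@_m.
Proof.
move=> ltmN; rewrite mcoeffM; apply: eq_bigr=> -[a b] /= _.
by rewrite !ms_truncE // (leq_trans (bmdeg _)).
Qed.

Lemma ms_mulA : associative ms_mul.
Proof.
move=> s t u; apply/funext=> m; rewrite !(@ms_mulE (mdeg m).+1) //.
transitivity ((ms_trunc (mdeg m).+1 s * (ms_trunc (mdeg m).+1 t *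
               ms_trunc (mdeg m).+1 u))@_m).
  rewrite !mcoeffM; apply: eq_bigr=> -[a b] /= _; congr (_ * _).
  by rewrite ms_truncE ?bmdeg // -ms_mulE ?bmdeg.
rewrite mulrA [LHS]mcoeffM [RHS]mcoeffM; apply: eq_bigr=> -[a b] /= _.
by congr (_ * _); rewrite ms_truncE ?bmdeg // -ms_mulE ?bmdeg.
Qed.

Lemma ms_mulC : commutative ms_mul.
Proof.
by move=> s t; apply/funext=> m; rewrite !(@ms_mulE (mdeg m).+1) // mulrC.
Qed.

Lemma ms_mul1 : left_id ms_one ms_mul.
Proof.
move=> s; apply/funext=> m; rewrite (@ms_mulE (mdeg m).+1) //.
transitivity ((1 * ms_trunc (mdeg m).+1 s)@_m); last by rewrite mul1r ms_truncE.
rewrite !mcoeffM; apply: eq_bigr=> -[a b] /= _; congr (_ * _).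
by rewrite ms_truncE ?bmdeg // mcoeff1 /ms_one.
Qed.

Lemma ms_mulDl : left_distributive ms_mul +%R.
Proof.
move=> s t u; apply/funext=> m; rewrite /ms_mul /= -[RHS]big_split /=.
by apply: eq_bigr=> p _; rewrite -mulrDl.
Qed.

HB.instance Definition _ := GRing.Zmodule_isComPzRing.Build S
  ms_mulA ms_mulC ms_mul1 ms_mulDl.

Lemma ms_mul_coefE N s t m : (mdeg m < N)%N ->
  (s * t) m =
    \sum_(p : 'X_{1..n < N, N} | m == (p.1 + p.2)%MM) s p.1 * t p.2.
Proof.
move=> ltmN; rewrite [LHS](ms_mulE _ _ ltmN) [LHS](mcoeff_poly_mul _ _ ltmN).
by apply: eq_bigr=> -[a b] /= _; rewrite !ms_truncE ?bmdeg.
Qed.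

Lemma ms_const1 : ms_const 1 = 1.
Proof. by apply/funext=> m; exact: mul1r. Qed.

Lemma ms_constD : {morph ms_const : a b / a + b}.
Proof. by move=> a b; apply/funext=> m; exact: mulrDl. Qed.

Lemma ms_constM : {morph ms_const : a b / a * b}.
Proof.
move=> a b; apply/funext=> m; rewrite [RHS](@ms_mulE (mdeg m).+1) //.
transitivity ((a%:MP_[n] * b%:MP_[n])@_m).
  by rewrite -mpolyCM mcoeffC.
rewrite !mcoeffM; apply: eq_bigr=> -[u v] /= _.
by congr (_ * _); rewrite ms_truncE ?bmdeg // mcoeffC.
Qed.

HB.instance Definition _ := hasAlgMap.Build R S ms_const1 ms_constD ms_constM.

End MSeries.

(* The divided power ring k_dp[x_1, ..., x_n], as a k-vector space: f@_m is   *)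
(* the coefficient of the divided power monomial x^[m].  Only the             *)
(* linear structure is provided, as the multiplication of {mpoly k[n]} is not *)
(* the divided power one.                                                     *)
Definition dpoly (R : comNzRingType) (n : nat) : Type := {mpoly R[n]}.
HB.instance Definition _ (R : comNzRingType) n := GRing.Lmodule.on (dpoly R n).

Definition dp_coef (R : comNzRingType) n (f : dpoly R n) (m : 'X_{1..n}) : R :=
  mcoeff m f.
Definition dp_monom (R : comNzRingType) n (m : 'X_{1..n}) : dpoly R n :=
  mpolyX R m.
Definition dp_deg_le (R : comNzRingType) n (d : nat) (f : dpoly R n) : Prop :=
  forall m, dp_coef f m != 0 -> (mdeg m <= d)%N.

Section Contraction.
Variables (R : comNzRingType) (n : nat).
Local Notation S := (mseries R n).
Local Notation P := (dpoly R n).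
Implicit Types (s t : S) (f g : P) (m : 'X_{1..n}).

(* Bilinear extension of x^u . x^[v] = x^[v - u] if u <= v, and 0 otherwise;  *)
(* msize f exceeds the degree of all monomials of f.                          *)
Definition contract s f : P :=
  \sum_(v : 'X_{1..n < msize f}) \sum_(u : 'X_{1..n < msize f} | (u <= v)%MM)
     (s u * dp_coef f v) *: dp_monom R (v - u)%MM.

Lemma dp_coef_ge f m : (msize f <= mdeg m)%N -> dp_coef f m = 0.
Proof. by move=> h; rewrite /dp_coef memN_msupp_eq0 // msize_mdeg_ge. Qed.

Lemma contract_coef s f N m : (msize f <= N)%N ->
  dp_coef (contract s f) m = \sum_(u : 'X_{1..n < N}) s u * dp_coef f (m + u).
Proof.
move=> leN.
transitivity (\sum_(u : 'X_{1..n < msize f}) s u * dp_coef f (m + u)); last first.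
  pose I1 : subFinType _ := 'X_{1..n < msize f}.
  pose I2 : subFinType _ := 'X_{1..n < N}.
  rewrite (big_sub_widen I1 I2 xpredT (fun u => s u * dp_coef f (m + u))) /=.
    apply: big_rmcond=> u; rewrite -leqNgt => h.
    by rewrite dp_coef_ge ?mulr0 // mdegD (leq_trans h) // leq_addl.
  by move=> x /leq_trans; apply.
rewrite /contract /dp_coef raddf_sum /=.
under eq_bigr => v _ do rewrite raddf_sum /= big_mkcond /=.
rewrite exchange_big /=; apply: eq_bigr=> u _.
have [lt|ge] := ltnP (mdeg (m + u)%MM) (msize f); last first.
  rewrite -[in RHS]/(dp_coef f _) dp_coef_ge // mulr0 big1 // => v _.
  case: ifP=> // le_uv; rewrite mcoeffZ mcoeffX.
  case: eqP=> [e|]; last by rewrite mulr0.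
  by move: (bmdeg v); rewrite ltnNge -(submK le_uv) e ge.
rewrite (bigD1 (BMultinom lt)) //= lem_addl addmK mcoeffZ mcoeffX eqxx mulr1.
rewrite big1 ?addr0 // => v ne; case: ifP=> // le_uv.
rewrite mcoeffZ mcoeffX; case: eqP=> [e|]; last by rewrite mulr0.
by case/eqP: ne; apply/val_inj; rewrite /= -e submK.
Qed.

Lemma dp_coefP f g : (forall m, dp_coef f m = dp_coef g m) -> f = g.
Proof. by move=> h; apply/mpolyP. Qed.

Definition Ann f : {pred S} := fun s => contract s f == 0.

Lemma AnnP f s N : (msize f <= N)%N ->
  reflect (forall m, \sum_(u : 'X_{1..n < N}) s u * dp_coef f (m + u) = 0)
          (s \in Ann f).
Proof.
move=> leN; apply: (iffP eqP)=> [h m|h].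
  by rewrite -contract_coef // h /dp_coef mcoeff0.
by apply/dp_coefP=> m; rewrite (contract_coef _ _ leN) h /dp_coef mcoeff0.
Qed.

Lemma Ann_zmod_closed f : zmod_closed (Ann f).
Proof.
split=> [|s t /(AnnP _ (leqnn _)) hs /(AnnP _ (leqnn _)) ht];
  apply/(AnnP _ (leqnn _)) => m.
  by rewrite big1 // => u _; exact: mul0r.
transitivity (\sum_(u : 'X_{1..n < msize f})
    (s u * dp_coef f (m + u) - t u * dp_coef f (m + u))).
  by apply: eq_bigr=> u _; rewrite -mulrBl.
by rewrite sumrB hs ht subrr.
Qed.

Lemma Ann_mulr f s t : t \in Ann f -> s * t \in Ann f.
Proof.
set N := msize f.
move=> /(AnnP _ (leqnn _)) ht; apply/(AnnP _ (leqnn _)) => m.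
under eq_bigr => w _ do
  rewrite (ms_mul_coefE _ _ (bmdeg w)) mulr_suml big_mkcond /=.
rewrite exchange_big /= -/N.
transitivity (\sum_(p : 'X_{1..n < N, N})
                 s p.1 * (t p.2 * dp_coef f (m + p.1 + p.2))).
  apply: eq_bigr=> -[a b] _ /=; rewrite -addmA.
  have [lt|ge] := ltnP (mdeg (a + b)%MM) N; last first.
    rewrite dp_coef_ge ?mulr0; last by rewrite mdegD (leq_trans ge) // leq_addl.
    rewrite big1 // => w _; case: eqP=> // e.
    by move: (bmdeg w); rewrite e ltnNge ge.
  rewrite (bigD1 (BMultinom lt)) //= eqxx big1 ?addr0 ?mulrA // => w ne.
  by case: eqP=> // e; case/eqP: ne; apply/val_inj.
rewrite -(pair_bigA _ (fun a b : 'X_{1..n < N} =>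
            s a * (t b * dp_coef f (m + a + b)))) /=.
by rewrite big1 // => a _; rewrite -mulr_sumr ht mulr0.
Qed.

HB.instance Definition _ f := GRing.isZmodClosed.Build S (Ann f)
  (Ann_zmod_closed f).
HB.instance Definition _ f := isIdealClosed.Build S (Ann f) (@Ann_mulr f).

Definition Apolar f : comPzAlgType R := alg_quot (Ann f).

End Contraction.

Section IdealPowers.
Variable A : comPzRingType.
Implicit Types (I J : set A) (i j : nat).

Definition ideal_mul I J : set A :=
  [set x | exists (n : nat) (a b : 'I_n -> A),
     (forall l, I (a l) /\ J (b l)) /\ x = \sum_(l < n) a l * b l].

Fixpoint ideal_pow I i : set A :=
  if i is j.+1 then ideal_mul (ideal_pow I j) I else setT.

Lemma ideal_pow_mull I i a x : ideal_pow I i x -> ideal_pow I i (a * x).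
Proof.
elim: i a x => [//|i IH] a x [n [b [c [h ->]]]].
exists n, (fun l => a * b l), c; split=> [l|].
  by have [hb hc] := h l; split=> //; exact: IH.
by rewrite mulr_sumr; apply: eq_bigr=> l _; rewrite mulrA.
Qed.

Lemma ideal_pow0 I i : ideal_pow I i 0.
Proof.
case: i => [//|i]; exists 0%N, (fun=> 0), (fun=> 0).
by split=> [[]//|]; rewrite big_ord0.
Qed.

Lemma ideal_powD I i x y :
  ideal_pow I i x -> ideal_pow I i y -> ideal_pow I i (x + y).
Proof.
case: i => [//|i] [n [a [b [h ->]]]] [p [c [e [g ->]]]].
exists (n + p)%N,
  (fun l => match fintype.split l with inl u => a u | inr v => c v end),
  (fun l => match fintype.split l with inl u => b u | inr v => e v end).
split=> [l|]; first by case: (fintype.split l).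
rewrite big_split_ord /=; congr (_ + _); apply: eq_bigr=> l _.
  by rewrite (unsplitK (inl _ l)).
by rewrite (unsplitK (inr _ l)).
Qed.

Lemma ideal_powB I i x y :
  ideal_pow I i x -> ideal_pow I i y -> ideal_pow I i (x - y).
Proof.
by move=> hx hy; apply: ideal_powD=> //; rewrite -mulN1r; apply: ideal_pow_mull.
Qed.

Lemma ideal_pow_sum I i (T : finType) (F : T -> A) :
  (forall t, ideal_pow I i (F t)) -> ideal_pow I i (\sum_t F t).
Proof.
by move=> h; apply: big_ind => //; [exact: ideal_pow0|exact: ideal_powD].
Qed.

Lemma ideal_powM I i j x y :
  ideal_pow I i x -> ideal_pow I j y -> ideal_pow I (i + j) (x * y).
Proof.
elim: j x y => [|j IH] x y hx.
  by move=> _; rewrite addn0 mulrC; exact: ideal_pow_mull.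
move=> [n [b [c [h ->]]]]; rewrite addnS.
exists n, (fun l => x * b l), c; split=> [l|].
  by have [hb hc] := h l; split=> //; exact: IH.
by rewrite mulr_sumr; apply: eq_bigr=> l _; rewrite mulrA.
Qed.

End IdealPowers.

(* The non-units of A: the maximal ideal of A when A is local. *)
Definition max_ideal (A : comPzRingType) : set A :=
  [set x | ~ exists y, x * y = 1].

(* dim_k (M / N) = e, for k-subspaces N of M of A: some b_1, ..., b_e in M    *)
(* induce a basis of M / N.                                                   *)
Definition dim_quot (k : pzRingType) (A : comPzAlgType k) (M N : set A)
    (e : nat) : Prop :=
  exists b : 'I_e -> A,
    [/\ forall j, M (b j),
        forall c : 'I_e -> k,
          N (\sum_(j < e) algmap (c j) * b j) -> forall j, c j = 0 &
        forall x, M x ->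
          exists c : 'I_e -> k, N (x - \sum_(j < e) algmap (c j) * b j)].

Definition has_hilbert_function (k : pzRingType) (A : comPzAlgType k)
    (h : nat -> nat) : Prop :=
  forall i,
    dim_quot (ideal_pow (@max_ideal A) i) (ideal_pow (@max_ideal A) i.+1) (h i).

(* Formal series sum_i (a i) T^i over A, as an ambient ring for the Rees      *)
(* algebra; {poly A} is unavailable as A may be zero.                         *)
Definition tseries (A : Type) : Type := nat -> A.

Section TSeries.
Variables (k : pzRingType) (A : comPzAlgType k).
Local Notation T := (tseries A).
Implicit Types (a b c : T).

HB.instance Definition _ := gen_eqMixin T.
HB.instance Definition _ := gen_choiceMixin T.

Definition ts_zero : T := fun=> 0.
Definition ts_const (x : A) : T := fun i => if i is 0%N then x else 0.
Definition ts_opp a : T := fun i => - a i.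
Definition ts_add a b : T := fun i => a i + b i.
Definition ts_mul a b : T := fun i => \sum_(j < i.+1) a j * b (i - j)%N.

Lemma ts_addA : associative ts_add.
Proof. by move=> a b c; apply/funext=> i; exact: addrA. Qed.
Lemma ts_addC : commutative ts_add.
Proof. by move=> a b; apply/funext=> i; exact: addrC. Qed.
Lemma ts_add0 : left_id ts_zero ts_add.
Proof. by move=> a; apply/funext=> i; exact: add0r. Qed.
Lemma ts_addN : left_inverse ts_zero ts_opp ts_add.
Proof. by move=> a; apply/funext=> i; exact: addNr. Qed.

HB.instance Definition _ := GRing.isZmodule.Build T
  ts_addA ts_addC ts_add0 ts_addN.

Lemma ts_mulC : commutative ts_mul.
Proof.
move=> a b; apply/funext=> i; rewrite /ts_mul (reindex_inj rev_ord_inj) /=.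
by apply: eq_bigr=> j _; rewrite subSS subKn ?leq_ord // mulrC.
Qed.

Lemma ts_mul_rev a b i : ts_mul a b i = \sum_(j < i.+1) a (i - j)%N * b j.
Proof.
by rewrite ts_mulC /ts_mul; apply: eq_bigr=> j _; rewrite mulrC.
Qed.

Lemma ts_mulA : associative ts_mul.
Proof.
move=> a b c; apply/funext=> i; rewrite [LHS]/ts_mul [RHS]ts_mul_rev.
pose F j l := a j * (b (i - j - l)%N * c l).
transitivity (\sum_(j < i.+1) \sum_(l < i.+1 | (l <= i - j)%N) F j l).
  apply: eq_bigr => /= j _; rewrite ts_mul_rev big_distrr /=.
  by rewrite (big_ord_narrow_leq (leq_subr _ _)).
rewrite (exchange_big_dep predT) //=; apply: eq_bigr => l _.
transitivity (\sum_(j < i.+1 | (j <= i - l)%N) F j l).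
  apply: eq_bigl => j; rewrite -ltnS -(ltnS j) -!subSn ?leq_ord //.
  by rewrite -subn_gt0 -(subn_gt0 j) -!subnDA addnC.
rewrite (big_ord_narrow_leq (leq_subr _ _)) big_distrl /=.
by apply: eq_bigr => j _; rewrite /F -!subnDA addnC mulrA.
Qed.

Lemma ts_mul_const x b i : ts_mul (ts_const x) b i = x * b i.
Proof.
by rewrite /ts_mul big_ord_recl subn0 big1 ?addr0 // => j _; rewrite mul0r.
Qed.

Lemma ts_mul1 : left_id (ts_const 1) ts_mul.
Proof. by move=> a; apply/funext=> i; rewrite ts_mul_const mul1r. Qed.

Lemma ts_mulDl : left_distributive ts_mul +%R.
Proof.
move=> a b c; apply/funext=> i; rewrite /ts_mul /= -[RHS]big_split /=.
by apply: eq_bigr=> p _; rewrite -mulrDl.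
Qed.

HB.instance Definition _ := GRing.Zmodule_isComPzRing.Build T
  ts_mulA ts_mulC ts_mul1 ts_mulDl.

Definition rees_pred : {pred T} := fun a =>
  `[< (forall i, ideal_pow (@max_ideal A) i (a i)) /\
      exists N, forall i, (N <= i)%N -> a i = 0 >].

Lemma rees_predP a :
  reflect ((forall i, ideal_pow (@max_ideal A) i (a i)) /\
           exists N, forall i, (N <= i)%N -> a i = 0) (a \in rees_pred).
Proof. exact: asboolP. Qed.

Lemma rees_const x : ts_const x \in rees_pred.
Proof.
apply/rees_predP; split; first by case=> // i; exact: ideal_pow0.
by exists 1%N => -[].
Qed.

Lemma rees_subring_closed : subring_closed rees_pred.
Proof.
split=> [|a b|a b]; first exact: rees_const.
  move=> /rees_predP[ha [N hN]] /rees_predP[hb [M hM]]; apply/rees_predP.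
  split=> [i|]; first exact: ideal_powB.
  exists (maxn N M) => i; rewrite geq_max => /andP[/hN ea /hM eb].
  by rewrite -[LHS]/(a i - b i) ea eb subr0.
move=> /rees_predP[ha [N hN]] /rees_predP[hb [M hM]]; apply/rees_predP.
split=> [i|].
  apply: ideal_pow_sum=> j; rewrite -[X in ideal_pow _ X](@subnKC j) ?leq_ord //.
  exact: ideal_powM.
exists (N + M)%N => i le; apply: big1=> j _.
have [/hN->|lt] := leqP N j; first by rewrite mul0r.
by rewrite hM ?mulr0 // leq_subRL ?leq_ord // (leq_trans _ le) // leq_add2r ltnW.
Qed.

(* The Rees algebra: the direct sum of the m^i T^i, m the maximal ideal. *)
Record rees := Rees { rees_val :> T; rees_valP : rees_val \in rees_pred }.

HB.instance Definition _ := [isSub for rees_val].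
HB.instance Definition _ := [Choice of rees by <:].
HB.instance Definition _ := GRing.SubChoice_isSubComPzRing.Build T rees_pred rees
  rees_subring_closed.

Definition rees_map (c : k) : rees := Rees (rees_const (algmap c)).

Lemma rees_map1 : rees_map 1 = 1.
Proof. by apply/val_inj/funext=> -[|i] //=; rewrite algmap1. Qed.

Lemma rees_mapD : {morph rees_map : a b / a + b}.
Proof.
move=> x y; apply/val_inj/funext=> i.
rewrite -[RHS]/(ts_const (algmap x) i + ts_const (algmap y) i).
by case: i => [|i] /=; rewrite ?algmapD ?addr0.
Qed.

Lemma rees_mapM : {morph rees_map : a b / a * b}.
Proof.
move=> x y; apply/val_inj/funext=> i.
rewrite -[RHS]/(ts_mul (ts_const (algmap x)) (ts_const (algmap y)) i).
by rewrite ts_mul_const; case: i => [|i] /=; rewrite ?algmapM ?mulr0.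
Qed.

HB.instance Definition _ := hasAlgMap.Build k rees rees_map1 rees_mapD rees_mapM.

(* The direct sum of the m^(i+1) T^i. *)
Definition rees_ideal : {pred rees} := fun u =>
  `[< forall i, ideal_pow (@max_ideal A) i.+1 (rees_val u i) >].

Lemma rees_ideal_zmod_closed : zmod_closed rees_ideal.
Proof.
split=> [|u v /asboolP hu /asboolP hv]; apply/asboolP=> i.
  exact: ideal_pow0.
exact: ideal_powB.
Qed.

Lemma rees_ideal_mulr (u : rees) :
  {in rees_ideal, forall v, u * v \in rees_ideal}.
Proof.
move=> v /asboolP hv; apply/asboolP=> i.
have /rees_predP[hu _] := rees_valP u.
apply: ideal_pow_sum=> j.
have := ideal_powM (hu j) (hv (i - j)%N).
by rewrite addnS subnKC // leq_ord.
Qed.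

HB.instance Definition _ := GRing.isZmodClosed.Build rees rees_ideal
  rees_ideal_zmod_closed.
HB.instance Definition _ := isIdealClosed.Build rees rees_ideal rees_ideal_mulr.

(* The associated graded algebra, the direct sum of the m^i / m^(i+1).        *)
Definition gr : comPzAlgType k := alg_quot rees_ideal.

End TSeries.

(* The Zariski topology on the affine space P_{<= d}, whose coordinates are   *)
(* the coefficients of the monomials x^[a] y^[b] with a + b <= d.             *)
Section Zariski.
Variables (k : fieldType) (d : nat).
Local Notation P := (dpoly k 2).

Definition P_le : set P := [set f | dp_deg_le d f].

Definition affine_dim : nat := #|{: 'X_{1..2 < d.+1}}|.

Definition dp_coords (f : P) : 'I_affine_dim -> k :=
  fun i => dp_coef f (enum_val i).

Definition zariski_closed (V : set P) : Prop :=
  exists E : set {mpoly k[affine_dim]},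
    V = P_le `&` [set f | forall p, E p -> p.@[dp_coords f] = 0].

(* Irreducibility of Z, and open subsets of Z, in the induced topology.       *)
Definition zariski_irreducible (Z : set P) : Prop :=
  Z !=set0 /\
  forall V W, zariski_closed V -> zariski_closed W ->
    Z `<=` V `|` W -> Z `<=` V \/ Z `<=` W.

Definition zariski_open_in (Z U : set P) : Prop :=
  exists V, zariski_closed V /\ U = Z `\` V.

End Zariski.
Arguments P_le : clear implicits.

(* The polynomials f of degree at most d with Apolar(f) of Hilbert function   *)
(* (1, 2, ..., 2, 1), with d - 1 twos.                                        *)
Definition Z_locus (k : fieldType) (d : nat) : set (dpoly k 2) :=
  P_le k d `&`
  [set f | has_hilbert_function (Apolar f)
             (nth 0%N (1 :: rcons (nseq d.-1 2) 1)%N)].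
Arguments Z_locus : clear implicits.

(* Main.v *)
(* Write f_d for the degree-d part of f.  The polynomial f lies in Z iff f_d depends *)
(* on both variables in any coordinates and Ann(f) contains a series of order two:  *)
(* such a series bounds the Hilbert function above by 2, and the catalecticants of  *)
(* f_d bound it below.  The pairs (sigma, f) with sigma of order 2 killing f form a *)
(* vector bundle over an open subset of affine space, since all such contractions   *)
(* have the same image P_(<= d-2); lifting two given f's along the pencil joining   *)
(* their sigma's gives a polynomial path inside Z, up to finitely many parameters,  *)
(* and hence irreducibility.  For general f the initial form of sigma has two       *)
(* distinct factors, which lift to sigma = ab modulo m^(d+1); then Apolar(f) is the *)
(* direct sum of the spaces spanned by a^i and b^i, a grading that splits the       *)
(* m-adic filtration.                                                               *)

Require Import Defs.
From HB Require Import structures.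
From mathcomp Require Import all_boot all_order all_algebra.
From mathcomp Require Import generic_quotient.
From mathcomp Require Import boolp classical_sets.
From mathcomp Require Import mpoly.
From mathcomp Require Import ring zify.

Set Implicit Arguments.
Unset Strict Implicit.
Unset Printing Implicit Defensive.

Import GRing.Theory.

Local Open Scope ring_scope.

(** Both halves of the theorem rest on [Z_locusP]: a polynomial f of degree at most d lies in Z
    exactly when Ann(f) contains a series sigma of order exactly two and some 2x2 minor of the first
    catalecticant of the top form f_d is nonzero. The quadric bounds the Hilbert function above by
    2; the minor propagates to all intermediate catalecticants ([hankel_minor_le]) and bounds it
    below.

    Irreducibility ([Z_locus_irreducible]): any two points f_1, f_2 of Z are joined by a polynomial
    path lying in Z for all but finitely many parameters. If sigma_1 kills f_1 and sigma_2 kills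
    f_2, the contractions by sigma_1 and sigma_2 have the same image ([contr_mx_sub]), so kernel
    elements can be carried polynomially along the pencil (1 - t) sigma_1 + t sigma_2
    ([path_in_pencil]). Were Z covered by two closed sets, f_1 outside one and f_2 outside the
    other, then equations nonzero at these points would restrict to nonzero polynomials in t, and a
    common non-root would give a point of Z outside both.

    Gradedness ([apolar_gr_of_factor]): when the polynomial [disc_of] does not vanish at f, sigma
    can be chosen with initial form l1 l2, where l1 and l2 are independent linear forms. The
    factorisation lifts to sigma = ab modulo m^(d+1) ([hensel_quadric]), so the classes x, y of a, b
    satisfy xy = 0, and the spans of x^i and y^i form a grading complementing m^(i+1) in m^i. Such a
    grading identifies Apolar(f) with its associated graded algebra ([split_filtration_gr]). The
    condition is nonempty because it holds at x^[d] + y^[d] ([disc_fermat]). *)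

Definition mon (a b : nat) : 'X_{1..2} := [multinom if i == ord0 then a else b | i < 2].

Lemma mdeg_mon a b : mdeg (mon a b) = (a + b)%N.
Proof. by rewrite mdegE !big_ord_recl big_ord0 !mnmE addn0. Qed.

Lemma mon0E a b : mon a b ord0 = a.
Proof. by rewrite mnmE. Qed.

Lemma mdeg2 (m : 'X_{1..2}) : mdeg m = (m ord0 + m ord_max)%N.
Proof.
rewrite mdegE !big_ord_recl big_ord0 addn0; congr (_ + m _)%N; exact/val_inj.
Qed.

Lemma monE (m : 'X_{1..2}) : m = mon (m ord0) (mdeg m - m ord0).
Proof.
apply/mnmP => i; rewrite mnmE mdeg2 addKn.
case: eqP => [->//|ne]; congr (m _); apply/val_inj.
by case: i ne => -[|[|//]] //= h []; apply/val_inj.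
Qed.

Lemma monP a b (m : 'X_{1..2}) : (m == mon a b) = (m ord0 == a) && (mdeg m == a + b)%N.
Proof.
apply/eqP/andP => [->|[/eqP e /eqP h]]; first by rewrite mon0E mdeg_mon !eqxx.
by rewrite (monE m) e h addKn.
Qed.

Lemma monD a b a' b' : (mon a b + mon a' b' = mon (a + a') (b + b'))%MM.
Proof. by apply/mnmP => i; rewrite mnmDE !mnmE; case: eqP. Qed.

(** * Homogeneous parts and order of power series in two variables *)

Section Forms.
Variable k : fieldType.
Local Notation S := (mseries k 2).
Implicit Types (s t : S) (p q : {mpoly k[2]}).

(* The degree-n part of s, dehomogenised by alpha -> 'X, beta -> 1. *)
Definition form s n : {poly k} := \poly_(a < n.+1) s (mon a (n - a)).

Lemma coef_form s n a : (form s n)`_a = if (a <= n)%N then s (mon a (n - a)) else 0.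
Proof. by rewrite coef_poly ltnS. Qed.

Lemma size_form s n : (size (form s n) <= n.+1)%N.
Proof. exact: size_poly. Qed.

Lemma formD s t n : form (s + t) n = form s n + form t n.
Proof. by apply/polyP => a; rewrite coefD !coef_form; case: ifP => // _; rewrite addr0. Qed.

Lemma formN s n : form (- s) n = - form s n.
Proof. by apply/polyP => a; rewrite coefN !coef_form; case: ifP => // _; rewrite oppr0. Qed.

Lemma formB s t n : form (s - t) n = form s n - form t n.
Proof. by rewrite formD formN. Qed.

Lemma form0 n : form 0 n = 0.
Proof. by apply/polyP => a; rewrite coef0 coef_form; case: ifP. Qed.

Lemma seriesP s t : (forall n, form s n = form t n) -> s = t.
Proof.
move=> h; apply/funext => m.
have := congr1 (fun p : {poly k} => p`_(m ord0)) (h (mdeg m)).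
by rewrite /= !coef_form -!monE mdeg2 leq_addr.
Qed.

(** Inverse of dehomogenisation: coefficients of [g] of index above [n] are never read, so [form]
    recovers [g] once its size is at most [n.+1]. *)
Definition hform n (g : {poly k}) : S :=
  fun m => if mdeg m == n then g`_(m ord0) else 0.

Lemma form_hform n (g : {poly k}) j : (size g <= n.+1)%N ->
  form (hform n g) j = if j == n then g else 0.
Proof.
move=> sg; apply/polyP => a; rewrite coef_form /hform mdeg_mon mon0E.
case: (leqP a j) => aj; last first.
  case: eqP => [e|_]; last by rewrite coef0.
  by rewrite nth_default // (leq_trans sg) // -e.
by rewrite subnKC //; case: eqP => // _; rewrite coef0.
Qed.

(* alpha -> XT, beta -> T separates an mpoly into its homogeneous parts. *)
Let vars (i : 'I_2) : {poly {poly k}} := if i == ord0 then 'X%:P * 'X else 'X.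
Let Phi : {mpoly k[2]} -> {poly {poly k}} := mmap (polyC \o polyC) vars.

Let PhiE p n a : (Phi p)`_n`_a = if (a <= n)%N then p@_(mon a (n - a)) else 0.
Proof.
have V m : mmap1 vars m = ('X^(m ord0))%:P * 'X^(mdeg m).
  rewrite /mmap1 !big_ord_recl big_ord0 mulr1 /vars /= mdeg2 exprMn exprD -!rmorphXn.
  by rewrite mulrA; congr (_ * 'X^(m _)); apply/val_inj.
rewrite /Phi /mmap coef_sum coef_sum.
under eq_bigr => m _.
  have -> : (((polyC \o polyC) p@_m * mmap1 vars m)`_n)`_a =
      p@_m * ((a == m ord0)%:R *+ (n == mdeg m)).
    rewrite V /= mulrA -polyCM coefCM coefXn mulr_natr coefMn coefCM coefXn.
    by do 2!case: (_ == _); rewrite ?mulr1n ?mulr0n ?mulr1 ?mulr0 ?mul0rn.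
  over.
rewrite /=.
case: leqP => an; last first.
  apply: big1 => m _; case: (n =P mdeg m) => [e|_]; last by rewrite mulr0n mulr0.
  have : (a == m ord0) = false by apply/eqP => e'; rewrite e e' mdeg2 in an; lia.
  by move=> ->; rewrite mulr1n mulr0.
transitivity (\sum_(m <- msupp p | m == mon a (n - a)) p@_m).
  rewrite [RHS]big_mkcond /=; apply: eq_bigr => m _.
  rewrite monP subnKC // [m ord0 == _]eq_sym [mdeg m == _]eq_sym.
  by do 2!case: eqP => //= _; rewrite ?mulr1n ?mulr0n ?mulr1 ?mulr0.
have [h|h] := boolP (mon a (n - a) \in msupp p); last first.
  rewrite memN_msupp_eq0 // big_seq_cond big1 // => m /andP[h1 /eqP e].
  by rewrite e (negbTE h) in h1.
by rewrite -big_filter filter_pred1_uniq ?msupp_uniq // big_seq1.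
Qed.

(** Dehomogenising loses nothing once the degree is recorded by T, so this Cauchy product is the
    multiplicativity of [Phi] applied to truncations. *)
Lemma form_mul s t n : form (s * t) n = \sum_(j < n.+1) form s j * form t (n - j).
Proof.
have E u j : (j < n.+1)%N -> (Phi (ms_trunc n.+1 u))`_j = form u j.
  move=> jn; apply/polyP => a; rewrite PhiE coef_form; case: leqP => // aj.
  by rewrite ms_truncE // mdeg_mon subnKC.
have PM : Phi (ms_trunc n.+1 s * ms_trunc n.+1 t) = Phi (ms_trunc n.+1 s) * Phi (ms_trunc n.+1 t).
  exact: rmorphM.
transitivity ((Phi (ms_trunc n.+1 s * ms_trunc n.+1 t))`_n).
  apply/polyP => a; rewrite PhiE coef_form; case: leqP => // an.
  by apply: (@ms_mulE _ _ n.+1); rewrite mdeg_mon subnKC.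
rewrite PM coefM; apply: eq_bigr => j _.
by rewrite !E // ltnS leq_subr.
Qed.

Lemma form1 n : form 1 n = (n == 0%N)%:R.
Proof.
have -> : (1 : S) = hform 0 1.
  apply/funext => m; rewrite /hform -[LHS]/((m == 0%MM)%:R) -mdeg_eq0.
  case: eqP => // h; have -> : m ord0 = 0%N by move: h; rewrite mdeg2; lia.
  by rewrite coef1.
by rewrite form_hform ?size_poly1 //; case: eqP.
Qed.

Lemma form_const (c : k) n : form (@ms_const k 2 c) n = if n == 0%N then c%:P else 0.
Proof.
have -> : @ms_const k 2 c = hform 0 c%:P.
  apply/funext => m; rewrite /hform /ms_const -mdeg_eq0.
  case: eqP => h; last by rewrite mulr0.
  have -> : m ord0 = 0%N by move: h; rewrite mdeg2; lia.
  by rewrite coefC mulr1.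
by rewrite form_hform ?size_polyC ?leq_b1.
Qed.

Lemma form_constM (c : k) s n : form (@ms_const k 2 c * s) n = c *: form s n.
Proof.
rewrite form_mul big_ord_recl subn0 form_const /= mul_polyC big1 ?addr0 // => j _.
by rewrite form_const /= mul0r.
Qed.

Lemma constM_coef c s u : (@ms_const k 2 c * s) u = c * s u.
Proof.
have := congr1 (fun p : {poly k} => p`_(u ord0)) (form_constM c s (mdeg u)).
by rewrite /= coefZ !coef_form -!monE mdeg2 leq_addr.
Qed.

Lemma form_sum (I : Type) (r : seq I) (P : pred I) (F : I -> S) n :
  form (\sum_(i <- r | P i) F i) n = \sum_(i <- r | P i) form (F i) n.
Proof. by apply: (big_morph (fun s => form s n)) => [s t|]; rewrite ?formD ?form0. Qed.

Definition ord_ge i s := forall j, (j < i)%N -> form s j = 0.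

Lemma ord_ge0 i : ord_ge i 0.
Proof. by move=> j _; rewrite form0. Qed.

Lemma ord_geD i s t : ord_ge i s -> ord_ge i t -> ord_ge i (s + t).
Proof. by move=> hs ht j ji; rewrite formD hs // ht // addr0. Qed.

Lemma ord_geN i s : ord_ge i s -> ord_ge i (- s).
Proof. by move=> hs j ji; rewrite formN hs // oppr0. Qed.

Lemma ord_geB i s t : ord_ge i s -> ord_ge i t -> ord_ge i (s - t).
Proof. by move=> hs ht; apply: ord_geD => //; apply: ord_geN. Qed.

Lemma ord_ge_leq i j s : (i <= j)%N -> ord_ge j s -> ord_ge i s.
Proof. by move=> ij hs l li; apply: hs; apply: leq_trans ij. Qed.

Lemma ord_geS i s : ord_ge i s -> form s i = 0 -> ord_ge i.+1 s.
Proof. by move=> hs h j; rewrite ltnS leq_eqVlt => /orP[/eqP->//|]; exact: hs. Qed.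

Lemma ord_geM i j s t : ord_ge i s -> ord_ge j t -> ord_ge (i + j) (s * t).
Proof.
move=> hs ht n nij; rewrite form_mul big1 // => l _.
have [li|il] := ltnP l i; first by rewrite hs // mul0r.
by rewrite ht ?mulr0 //; have := ltn_ord l; lia.
Qed.

Lemma form_mul_lead i j s t : ord_ge i s -> ord_ge j t ->
  form (s * t) (i + j) = form s i * form t j.
Proof.
move=> hs ht; have il : (i < (i + j).+1)%N by lia.
rewrite form_mul (bigD1 (Ordinal il)) //= addKn big1 ?addr0 // => l ne.
have [li|il'] := ltnP l i; first by rewrite hs // mul0r.
rewrite ht ?mulr0 //; have := ltn_ord l.
have : (val l != i) by apply: contraNneq ne => e; apply/eqP/val_inj.
by move: il' => /=; lia.
Qed.

Lemma ord_ge_hform n (g : {poly k}) : (size g <= n.+1)%N -> ord_ge n (hform n g).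
Proof. by move=> sg j jn; rewrite form_hform // (ltn_eqF jn). Qed.

Lemma ord_ge_constM i (c : k) s : ord_ge i s -> ord_ge i (@ms_const k 2 c * s).
Proof. by move=> hs j ji; rewrite form_constM hs // scaler0. Qed.

Lemma ord_geX i s n : ord_ge i s -> ord_ge (i * n) (s ^+ n).
Proof.
move=> hs; elim: n => [|n IH]; first by rewrite muln0.
by rewrite exprS mulnS; apply: ord_geM.
Qed.

Lemma form_expX i s n : ord_ge i s -> form (s ^+ n) (i * n) = form s i ^+ n.
Proof.
move=> hs; elim: n => [|n IH]; first by rewrite muln0 form1.
by rewrite !exprS mulnS form_mul_lead ?IH //; exact: ord_geX.
Qed.

Lemma ord_ge_coef i s m : ord_ge i s -> (mdeg m < i)%N -> s m = 0.
Proof.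
move=> hs mi; have := congr1 (fun p : {poly k} => p`_(m ord0)) (hs _ mi).
by rewrite /= coef_form coef0 -!monE mdeg2 leq_addr.
Qed.

Lemma ord_geP i s : (forall m, (mdeg m < i)%N -> s m = 0) -> ord_ge i s.
Proof.
move=> h j ji; apply/polyP => a; rewrite coef_form coef0; case: leqP => // aj.
by rewrite h // mdeg_mon subnKC.
Qed.

(* hform 1 'X and hform 1 1 are alpha and beta. *)
Lemma ord_ge_split i s : ord_ge i.+1 s -> exists t u, 
  [/\ ord_ge i t, ord_ge i u & s = t * hform 1 'X + u * hform 1 1].
Proof.
move=> hs.
pose t : S := fun m => s (m + mon 1 0)%MM.
pose u : S := fun m => if m ord0 == 0%N then s (m + mon 0 1)%MM else 0.
exists t, u; split.
- by apply: ord_geP => m mi; apply: (ord_ge_coef hs); rewrite mdegD mdeg_mon; lia.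
- apply: ord_geP => m mi; rewrite /u; case: ifP => // _.
  by apply: (ord_ge_coef hs); rewrite mdegD mdeg_mon; lia.
apply: seriesP => n; case: n => [|n].
  rewrite hs // formD !form_mul !big_ord_recl !big_ord0 /= !form_hform ?size_polyX ?size_poly1 //.
  by rewrite /= !mulr0 !addr0.
have E v (g : {poly k}) : (size g <= 2)%N -> form (v * hform 1 g) n.+1 = form v n * g.
  move=> sg; have H j : form (hform 1 g) j = if j == 1%N then g else 0 by rewrite form_hform.
  rewrite form_mul 2!big_ord_recr /= !H subnn subSnn /= mulr0 addr0 big1 ?add0r // => j _.
  by rewrite H; case: eqP => [|_]; [move=> /=; have := ltn_ord j; clear; lia | rewrite mulr0].
rewrite formD !E ?size_polyX ?size_poly1 // mulr1; apply/polyP => a.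
rewrite coefD coefMX !coef_form /t /u !monD mon0E !addn0.
case: a => [|a] /=; first by rewrite add0r !subn0 addn1.
rewrite ltnS subSS addn1; rewrite (_ : (if (a < n)%N then _ else _) = 0) ?addr0 //.
by case: ifP.
Qed.

End Forms.

(** * The pairing of series with polynomials, Ann(f), and the maximal ideal of Apolar(f) *)

Section Pairing.
Variable k : fieldType.
Local Notation S := (mseries k 2).
Implicit Types (s t : S) (f : dpoly k 2).

(** For f of degree at most d this is the constant coefficient of the contraction of f by s. *)
Definition pair d f s : k := \sum_(u : 'X_{1..2 < d.+1}) s u * dp_coef f u.

(* The coefficients of the degree-d part of f, indexed by the exponent of x; lam pairs *)
(* it with the degree-d form that dehomogenises to g.                                *)
Definition top d f a : k := dp_coef f (mon a (d - a)).

Definition lam d f (g : {poly k}) : k := \sum_(a < d.+1) g`_a * top d f a.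

Lemma pairD d f s t : pair d f (s + t) = pair d f s + pair d f t.
Proof. by rewrite -[RHS]big_split; apply: eq_bigr => u _; exact: mulrDl. Qed.

Lemma lamD d f g h : lam d f (g + h) = lam d f g + lam d f h.
Proof. by rewrite -[RHS]big_split; apply: eq_bigr => u _; rewrite coefD mulrDl. Qed.

Lemma lamZ d f c g : lam d f (c *: g) = c * lam d f g.
Proof. by rewrite mulr_sumr; apply: eq_bigr => u _; rewrite coefZ mulrA. Qed.

Lemma lamXn d f a : (a <= d)%N -> lam d f 'X^a = top d f a.
Proof.
rewrite -ltnS => ad; rewrite /lam (bigD1 (Ordinal ad)) //= coefXn eqxx mul1r.
rewrite big1 ?addr0 // => b; rewrite -val_eqE coefXn /= => /negbTE ->.
by rewrite mul0r.
Qed.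

Lemma lam0 d f : lam d f 0 = 0.
Proof. by rewrite -(scale0r (0 : {poly k})) lamZ mul0r. Qed.

Lemma lamN d f g : lam d f (- g) = - lam d f g.
Proof. by rewrite -scaleN1r lamZ mulN1r. Qed.

Lemma pair_ord d f s : ord_ge d.+1 s -> pair d f s = 0.
Proof. by move=> hs; apply: big1 => u _; rewrite (ord_ge_coef hs) ?mul0r ?bmdeg. Qed.

Lemma pair_lead d f s : ord_ge d s -> pair d f s = lam d f (form s d).
Proof.
move=> hs; rewrite /pair (bigID (fun u : 'X_{1..2 < d.+1} => mdeg u == d)) /=.
rewrite [X in _ + X]big1 ?addr0; last first.
  move=> u ud; rewrite (ord_ge_coef hs) ?mul0r //.
  by rewrite ltn_neqAle ud -ltnS bmdeg.
have lt (a : 'I_d.+1) : (mdeg (mon a (d - a)) < d.+1)%N.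
  by rewrite mdeg_mon subnKC // -ltnS.
rewrite (reindex_onto (fun a : 'I_d.+1 => BMultinom (lt a))
           (fun u : 'X_{1..2 < d.+1} => inord ((u : 'X_{1..2}) ord0))) /=; last first.
  move=> u /eqP ud; apply/val_inj => /=; rewrite [RHS]monE ud inordK // ltnS.
  by apply: (@leq_trans (mdeg u)); [rewrite mdeg2 leq_addr|rewrite ud].
apply: eq_big => [a|a _].
  by rewrite mdeg_mon subnKC -1?ltnS // eqxx mon0E inord_val eqxx.
by rewrite coef_form -ltnS ltn_ord.
Qed.

Lemma msize_P_le d f : P_le k d f -> (msize f <= d.+1)%N.
Proof.
move=> hf; rewrite msizeE; apply/bigmax_leqP_seq => m mf _.
by rewrite ltnS; apply: hf; rewrite /dp_coef -mcoeff_msupp.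
Qed.

Lemma pair_mul d f s t : P_le k d f -> pair d f (s * t) =
  \sum_(a : 'X_{1..2 < d.+1}) s a * \sum_(b : 'X_{1..2 < d.+1}) t b * dp_coef f (a + b).
Proof.
move=> /msize_P_le hf; rewrite /pair.
under eq_bigr => w _ do
  rewrite (ms_mul_coefE _ _ (bmdeg w)) mulr_suml big_mkcond /=.
rewrite exchange_big /=.
transitivity (\sum_(p : 'X_{1..2 < d.+1, d.+1})
                 s p.1 * (t p.2 * dp_coef f (p.1 + p.2))).
  apply: eq_bigr=> -[a b] _ /=.
  have [lt|ge] := ltnP (mdeg (a + b)%MM) d.+1; last first.
    rewrite dp_coef_ge ?(leq_trans hf) // !mulr0 big1 // => w _; case: eqP=> // e.
    by move: (bmdeg w); rewrite e ltnNge ge.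
  rewrite (bigD1 (BMultinom lt)) //= eqxx big1 ?addr0 ?mulrA // => w ne.
  by case: eqP=> // e; case/eqP: ne; apply/val_inj.
rewrite -(pair_bigA _ (fun a b : 'X_{1..2 < d.+1} => s a * (t b * dp_coef f (a + b)))) /=.
by apply: eq_bigr => a _; rewrite -mulr_sumr.
Qed.

(** The coefficient of the contraction at x^[m] is the pairing with s times the monomial m, so s
    kills f iff the ideal generated by s pairs to zero with f. *)
Lemma Ann_pairP d f s : P_le k d f ->
  (s \in Ann f) <-> (forall w, pair d f (s * w) = 0).
Proof.
move=> hf; have hm := msize_P_le hf; split=> [/(AnnP _ hm) h w|h].
  by rewrite mulrC pair_mul // big1 // => a _; rewrite h mulr0.
apply/(AnnP _ hm) => m.
have [lt|ge] := ltnP (mdeg m) d.+1; last first.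
  rewrite big1 // => u _; rewrite dp_coef_ge ?mulr0 // mdegD.
  by rewrite (leq_trans hm) // (leq_trans ge) // leq_addr.
have := h (fun u => (u == m)%:R); rewrite mulrC pair_mul //.
rewrite (bigD1 (BMultinom lt)) //= eqxx mul1r [X in _ + X]big1 ?addr0 // => u.
by rewrite -val_eqE /= => /negbTE ->; rewrite mul0r.
Qed.

Section AnnForm.
Variables (d : nat) (f : dpoly k 2) (hf : P_le k d f).

Lemma ord_Ann s : ord_ge d.+1 s -> s \in Ann f.
Proof.
move=> hs; apply/(Ann_pairP _ hf) => w; apply: pair_ord.
by have := ord_geM hs (fun j (h : (j < 0)%N) => ltac:(done) : form w j = 0); rewrite addn0.
Qed.

(** The initial form of an annihilator of f kills the top form f_d: multiplied up to degree d, it is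
    the only part of the product that meets f. *)
Lemma Ann_lam i p s : s \in Ann f -> ord_ge i s -> (i + p <= d)%N ->
  lam d f (form s i * 'X^p) = 0.
Proof.
move=> /(Ann_pairP _ hf) h hs ipd.
have sz : (size ('X^p : {poly k}) <= (d - i).+1)%N by rewrite size_polyXn; lia.
have hw := ord_ge_hform sz.
have e : (i + (d - i))%N = d by lia.
have := form_mul_lead hs hw; have := ord_geM hs hw; rewrite e => h1 h2.
by have := h (hform (d - i)%N 'X^p); rewrite pair_lead // h2 form_hform // eqxx.
Qed.

(** A series of order d sends f to a constant, namely its pairing with f_d. *)
Lemma lam_Ann s : ord_ge d s -> lam d f (form s d) = 0 -> s \in Ann f.
Proof.
move=> hs h; apply/(Ann_pairP _ hf) => w.
have w0 : ord_ge 0 w by [].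
have hd : ord_ge d (s * w) by rewrite -(addn0 d); exact: ord_geM.
have := form_mul_lead hs w0; rewrite addn0 pair_lead // => ->.
have -> : form w 0 = ((form w 0)`_0)%:P by apply: size1_polyC; exact: size_form.
by rewrite mulrC mul_polyC lamZ h mulr0.
Qed.

Lemma Ann1_top a : (1 : S) \in Ann f -> (a <= d)%N -> top d f a = 0.
Proof.
move=> h ad; have o0 : ord_ge 0 (1 : S) by [].
by have := Ann_lam h o0 (p := a) ad; rewrite form1 mul1r lamXn.
Qed.

End AnnForm.

Definition cls f s : Apolar f := (\pi_(alg_quot (Ann f)) s)%qT.

Lemma clsP f s t : cls f s = cls f t <-> s - t \in Ann f.
Proof. exact: alg_quot_eqP. Qed.

Lemma clsD f s t : cls f (s + t) = cls f s + cls f t.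
Proof. exact: pi_algD. Qed.

Lemma clsM f s t : cls f (s * t) = cls f s * cls f t.
Proof. exact: pi_algM. Qed.

Lemma cls_is_nmod f : nmod_morphism (cls f).
Proof.
split; last exact: clsD.
by apply: (addrI (cls f 0)); rewrite -clsD !addr0.
Qed.

HB.instance Definition _ f := GRing.isNmodMorphism.Build S (Apolar f) (cls f) (cls_is_nmod f).

Lemma cls_is_monoid f : monoid_morphism (cls f).
Proof. by split=> // s t; exact: clsM. Qed.

HB.instance Definition _ f := GRing.isMonoidMorphism.Build S (Apolar f) (cls f) (cls_is_monoid f).

Lemma cls_surj f (x : Apolar f) : exists s, x = cls f s.
Proof. by exists (repr x); rewrite /cls reprK. Qed.

Lemma cls_const f c : cls f (@ms_const k 2 c) = algmap c.
Proof. by []. Qed.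

Lemma cls0P f s : cls f s = 0 <-> s \in Ann f.
Proof. by rewrite -(rmorph0 (cls f)) clsP subr0. Qed.

Section Powers.
Variables (d : nat) (f : dpoly k 2) (hf : P_le k d f).
Local Notation cl := (cls f).

(** After scaling, s is 1 - n with n of order at least one; the geometric series inverts it because
    n^(d+1) kills f. *)
Lemma cls_unit s : form s 0 != 0 -> exists y, cl s * y = 1.
Proof.
move=> s0; pose c := (form s 0)`_0.
have e : form s 0 = c%:P by apply: size1_polyC; exact: size_form.
have c0 : c != 0 by apply: contraNneq s0 => c0; rewrite e c0.
pose n : S := 1 - @ms_const k 2 c^-1 * s.
have hn : ord_ge 1 n.
  move=> [|//] _; rewrite /n formB form1 form_constM e -mul_polyC -polyCM mulVf //.
  exact: subrr.
have [y hy] : exists y, (1 - n) * y = 1 - n ^+ d.+1.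
  elim: d.+1 => [|N [y hy]]; first by exists 0; rewrite mulr0 expr0 subrr.
  by exists (1 + n * y); rewrite mulrDr mulrCA hy exprS; ring.
exists (cl (@ms_const k 2 c^-1 * y)).
rewrite -rmorphM mulrCA mulrA; have -> : @ms_const k 2 c^-1 * s = 1 - n by rewrite /n; ring.
rewrite hy rmorphB rmorph1; apply/eqP; rewrite subr_eq addrC -subr_eq subrr eq_sym; apply/eqP.
apply/cls0P/(ord_Ann hf); by have := ord_geX (n := d.+1) hn; rewrite mul1n.
Qed.

Hypothesis nz : (1 : Apolar f) <> 0.

Lemma max_idealP x : max_ideal x <-> exists s, x = cl s /\ ord_ge 1 s.
Proof.
split=> [hx|[s [-> hs]] [y]].
  have [s es] := cls_surj x; exists s; split=> // -[|//] _.
  by apply/eqP/negP => /negP /cls_unit; rewrite -es.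
have [t ->] := cls_surj y; rewrite -rmorphM => h.
apply: nz; rewrite -(expr1n _ d.+1) -h -rmorphXn; apply/cls0P/(ord_Ann hf).
have t0 : ord_ge 0 t by [].
by have := ord_geX (n := d.+1) (ord_geM hs t0); rewrite mul1n.
Qed.

(** The maximal ideal is the image of m, the series of order at least one, and [ord_ge_split] shows
    that order at least i describes m^i; membership in powers thus becomes a condition on order. *)
Lemma ideal_powP i x :
  ideal_pow (@max_ideal (Apolar f)) i x <-> exists s, x = cl s /\ ord_ge i s.
Proof.
elim: i x => [|i IH] x /=.
  by split=> // _; have [s ->] := cls_surj x; exists s.
split=> [[n [a [b [hab ->]]]]|[s [-> hs]]].
  elim/big_ind: _ => [|_ _ [s [-> hs]] [t [-> ht]]|l _].
  - by exists 0; split; [rewrite rmorph0|exact: ord_ge0].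
  - by exists (s + t); split; [rewrite rmorphD|exact: ord_geD].
  have [/IH[s [-> hs]] /max_idealP[t [-> ht]]] := hab l.
  by exists (s * t); split; [rewrite rmorphM|rewrite -addn1; exact: ord_geM].
have [t [u [ht hu ->]]] := ord_ge_split hs.
have X1 : (size ('X : {poly k}) <= 2)%N by rewrite size_polyX.
have X0 : (size (1%R : {poly k}) <= 2)%N by rewrite size_poly1.
exists 2%N, (fun l => if l == ord0 then cl t else cl u),
  (fun l => if l == ord0 then cl (hform 1 'X) else cl (hform 1 1)); split=> [l|].
  case: ifP => _; split.
  - by apply/IH; exists t.
  - by apply/max_idealP; exists (hform 1 'X); split=> //; exact: ord_ge_hform.
  - by apply/IH; exists u.
  - by apply/max_idealP; exists (hform 1 1); split=> //; exact: ord_ge_hform.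
by rewrite !big_ord_recl big_ord0 /= addr0 rmorphD !rmorphM.
Qed.

Lemma ideal_pow_cls i s : ideal_pow (@max_ideal (Apolar f)) i (cl s) <->
  exists t, s - t \in Ann f /\ ord_ge i t.
Proof.
rewrite ideal_powP; split=> -[t [h ht]]; exists t; split=> //; exact/clsP.
Qed.

End Powers.
End Pairing.

(** * Linear algebra: bases of binary forms, Hankel minors, dimensions of quotients *)

Section LinearAlgebra.
Variable k : fieldType.

Lemma poly_basis_span n (b : 'I_n -> {poly k}) :
  (forall r, (size (b r) <= n)%N) ->
  (forall c : 'I_n -> k, \sum_r c r *: b r = 0 -> forall r, c r = 0) ->
  forall g : {poly k}, (size g <= n)%N -> exists c : 'I_n -> k, g = \sum_r c r *: b r.
Proof.
move=> sb fb g sg; pose M : 'M[k]_n := \matrix_r poly_rV (b r).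
have E (v : 'rV[k]_n) : rVpoly (v *m M) = \sum_r v 0 r *: b r.
  rewrite mulmx_sum_row linear_sum; apply: eq_bigr => r _.
  by rewrite linearZ /= rowK poly_rV_K.
have uM : M \in unitmx.
  rewrite -row_free_unit; apply: inj_row_free => v vM.
  apply/rowP => r; rewrite mxE; apply: (fb (fun r => v 0 r)).
  by rewrite -E vM linear0.
by exists (fun r => (poly_rV g *m invmx M) 0 r); rewrite -E mulmxKV // poly_rV_K.
Qed.

(** A dimension count: [A], [B] and the j products q X^r are j + 2 independent elements in a space
    of dimension j + 2. *)
Lemma poly_two_span j (A B q : {poly k}) : (size A <= j.+2)%N -> (size B <= j.+2)%N ->
  (size q <= 3)%N -> q != 0 ->
  (forall c1 c2 (h : {poly k}), (size h <= j)%N -> c1 *: A + c2 *: B + q * h = 0 -> c1 = 0 /\ c2 = 0) ->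
  forall g : {poly k}, (size g <= j.+2)%N ->
  exists c1 c2 (h : {poly k}), (size h <= j)%N /\ g = c1 *: A + c2 *: B + q * h.
Proof.
move=> sA sB sq q0 ind g sg.
pose b (r : 'I_j.+2) : {poly k} :=
  if val r is r'.+1 then if r' is r''.+1 then q * 'X^r'' else B else A.
pose H (c : 'I_j.+2 -> k) : {poly k} := \sum_(r < j) c (lift ord0 (lift ord0 r)) *: 'X^r.
have sH c : (size (H c) <= j)%N.
  apply: (leq_trans (size_sum _ _ _)); apply/bigmax_leqP => r _.
  by apply: (leq_trans (size_scale_leq _ _)); rewrite size_polyXn.
have E (c : 'I_j.+2 -> k) : \sum_r c r *: b r =
    c ord0 *: A + c (lift ord0 ord0) *: B + q * H c.
  rewrite !big_ord_recl addrA /H mulr_sumr; congr (_ + _).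
  by apply: eq_bigr => r _; rewrite -scalerAr.
have sb r : (size (b r) <= j.+2)%N.
  rewrite /b; case: r => -[|[|r]] //= rj; apply: (leq_trans (size_polyMleq _ _)).
  by rewrite size_polyXn; move: rj sq; clear; lia.
have [|c ->] := poly_basis_span sb _ sg; last by rewrite E; exists (c ord0), (c (lift ord0 ord0)), (H c).
move=> c; rewrite E => h; have [c1 c2] := ind _ _ _ (sH c) h.
move: h; rewrite c1 c2 !scale0r !add0r => /eqP; rewrite mulf_eq0 (negbTE q0) /= => /eqP Hc.
move=> r; case: (unliftP ord0 r) => [r'|] -> //; case: (unliftP ord0 r') => [r''|] -> //.
have := congr1 (fun p : {poly k} => p`_r'') Hc; rewrite /H coef_sum coef0 (bigD1 r'') //=.
rewrite coefZ coefXn eqxx mulr1 big1 ?addr0 // => s ne.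
by rewrite coefZ coefXn [_ == _ :> nat]eq_sym (inj_eq val_inj) (negbTE ne) mulr0.
Qed.

Lemma det2_kernel (x y z w : k) : x * w = y * z ->
  exists c1 c2, ((c1 != 0) || (c2 != 0)) /\ (c1 * x + c2 * z = 0 /\ c1 * y + c2 * w = 0).
Proof.
move=> e; case: (boolP ((x != 0) || (z != 0))) => h1.
  by exists z, (- x); split; [rewrite oppr_eq0 orbC|split; [ring|rewrite mulNr e; ring]].
case: (boolP ((y != 0) || (w != 0))) => h2.
  by exists w, (- y); split; [rewrite oppr_eq0 orbC|split; [rewrite mulrC e; ring|ring]].
move: h1 h2; rewrite !negb_or !negbK => /andP[/eqP-> /eqP->] /andP[/eqP-> /eqP->].
by exists 1, 0; split; [rewrite oner_eq0|rewrite !mulr0 addr0].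
Qed.

Lemma det2_inj (x y z w c1 c2 : k) : x * w != y * z ->
  c1 * x + c2 * z = 0 -> c1 * y + c2 * w = 0 -> c1 = 0 /\ c2 = 0.
Proof.
rewrite -subr_eq0 => D h1 h2; split; apply/eqP.
  have : c1 * (x * w - y * z) = 0.
    transitivity (w * (c1 * x + c2 * z) - z * (c1 * y + c2 * w)); first by ring.
    by rewrite h1 h2; ring.
  by move/eqP; rewrite mulf_eq0 (negbTE D) orbF.
have : c2 * (x * w - y * z) = 0.
  transitivity (x * (c1 * y + c2 * w) - y * (c1 * x + c2 * z)); first by ring.
  by rewrite h1 h2; ring.
by move/eqP; rewrite mulf_eq0 (negbTE D) orbF.
Qed.

(* The i-th catalecticant of a binary form of degree d is the Hankel matrix *)
(* (c_(a+p)), a <= i, p <= d - i; for 0 < i < d, rank >= 2 does not depend on i. *)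
Definition hankel_minor (c : nat -> k) d i :=
  exists a a' p p', [/\ (a <= i)%N, (a' <= i)%N, (p <= d - i)%N, (p' <= d - i)%N &
    c (a + p)%N * c (a' + p')%N != c (a + p')%N * c (a' + p)%N].

(** By contraposition: if all minors of the next catalecticant vanish, so do those of the present
    one. Moving one unit of index from column to row reduces to columns below [d - i], except when
    the columns are 0 and [d - i]. *)
Lemma hankel_minorS (c : nat -> k) d i : (i.+2 <= d)%N ->
  hankel_minor c d i -> hankel_minor c d i.+1.
Proof.
move=> id [a [a' [p [p' [ai a'i pi p'i ne]]]]].
apply: contrapT => no.
have V b b' q q' : (b <= i.+1)%N -> (b' <= i.+1)%N -> (q < d - i)%N -> (q' < d - i)%N ->
    c (b + q)%N * c (b' + q')%N = c (b + q')%N * c (b' + q)%N.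
  move=> h1 h2 h3 h4; apply/eqP; apply: contrapT => /negP h; apply: no.
  by exists b, b', q, q'; split=> //; rewrite subnS -ltnS prednK //; lia.
(* The pair of extreme columns, by the chain c_b c_(b'+e+1) = c_(b+e) c_(b'+1) = c_(b+1) c_(b'+e) =
   c_(b+e+1) c_b', where e + 1 = d - i. *)
have W b b' : (b <= i)%N -> (b' <= i)%N ->
    c b * c (b' + (d - i))%N = c (b + (d - i))%N * c b'.
  move=> h1 h2; have [e eE] : exists e, (d - i = e.+1)%N by exists (d - i.+1)%N; lia.
  have := V b b'.+1 0%N e ltac:(lia) ltac:(lia) ltac:(lia) ltac:(lia).
  have := V b.+1 b' 0%N e ltac:(lia) ltac:(lia) ltac:(lia) ltac:(lia).
  have := V b b' 1%N e ltac:(lia) ltac:(lia) ltac:(lia) ltac:(lia).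
  by rewrite eE !addn0 !addn1 !addnS !addSn => -> <- ->.
case/eqP: ne; case: (ltnP p (d - i)) => hp; case: (ltnP p' (d - i)) => hp'.
- by apply: V => //; lia.
- have -> : p' = (d - i)%N by lia.
  case: p pi hp => [|p] pi hp; first by rewrite !addn0; exact: W.
  have [e eE] : exists e, (d - i = e.+1)%N by exists (d - i.+1)%N; lia.
  have := V a.+1 a'.+1 p e ltac:(lia) ltac:(lia) ltac:(lia) ltac:(lia).
  by rewrite eE !addnS !addSn.
- have -> : p = (d - i)%N by lia.
  case: p' p'i hp' => [|p'] p'i hp'; first by rewrite !addn0; rewrite W //.
  have [e eE] : exists e, (d - i = e.+1)%N by exists (d - i.+1)%N; lia.
  have := V a.+1 a'.+1 e p' ltac:(lia) ltac:(lia) ltac:(lia) ltac:(lia).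
  by rewrite eE !addnS !addSn.
have -> : p = (d - i)%N by lia.
by have -> : p' = (d - i)%N by lia.
Qed.

Lemma hankel_minor_le (c : nat -> k) d i : (0 < i < d)%N ->
  hankel_minor c d 1 -> hankel_minor c d i.
Proof.
case: i => // i /= id h1; elim: i id => // i IH id.
by apply: hankel_minorS => //; apply: IH; lia.
Qed.

Variable A : comPzAlgType k.

Lemma algmap0 : algmap (0 : k) = 0 :> A.
Proof. by apply: (addrI (algmap 0)); rewrite -algmapD !addr0. Qed.

Lemma algmap_sum (I : Type) (r : seq I) (F : I -> k) :
  algmap (\sum_(i <- r) F i) = \sum_(i <- r) algmap (F i) :> A.
Proof. by apply: (big_morph _ (@algmapD _ _) algmap0). Qed.

Local Notation comb c g := (\sum_l algmap (c l) * g l).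

Lemma dim_quot_coords (I : set A) i e m (b : 'I_e -> A) (g : 'I_m -> A) :
  (forall l, exists c : 'I_e -> k, ideal_pow I i (g l - comb c b)) ->
  exists G : 'M[k]_(m, e), forall c : 'rV[k]_m,
    ideal_pow I i (comb (c 0) g - comb ((c *m G) 0) b).
Proof.
move=> /boolp.choice [G hG]; exists (\matrix_(l, j) G l j) => c.
have -> : comb (c 0) g - comb ((c *m \matrix_(l, j) G l j) 0) b =
    \sum_l algmap (c 0 l) * (g l - comb (G l) b).
  under [in RHS]eq_bigr => l _ do rewrite mulrBr.
  rewrite sumrB; congr (_ - _).
  under eq_bigr => j _ do rewrite mxE algmap_sum mulr_suml.
  rewrite exchange_big /=; apply: eq_bigr => l _; rewrite mulr_sumr.
  by apply: eq_bigr => j _; rewrite mxE algmapM mulrA.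
by apply: ideal_pow_sum => l; apply: ideal_pow_mull.
Qed.

Lemma dim_quot_dep (I : set A) i e m (g : 'I_m -> A) :
  dim_quot (ideal_pow I i) (ideal_pow I i.+1) e -> (e < m)%N ->
  (forall l, ideal_pow I i (g l)) ->
  exists c : 'rV[k]_m, c != 0 /\ ideal_pow I i.+1 (comb (c 0) g).
Proof.
move=> [b [_ _ sp]] em hg.
have [G hG] := dim_quot_coords (fun l => sp _ (hg l)).
have /rowV0Pn[c /sub_kermxP cG c0] : kermx G != 0.
  rewrite -mxrank_eq0 mxrank_ker; have := rank_leq_col G; lia.
exists c; split=> //; have := hG c; rewrite cG [X in _ - X]big1 ?subr0 // => j _.
by rewrite mxE algmap0 mul0r.
Qed.

(** As many spanning elements as the dimension form a basis: the coordinate matrices between [g] and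
    [b] satisfy B G = 1, hence are square inverses of each other. *)
Lemma dim_quot_span_free (I : set A) i e (g : 'I_e -> A) :
  dim_quot (ideal_pow I i) (ideal_pow I i.+1) e ->
  (forall l, ideal_pow I i (g l)) ->
  (forall x, ideal_pow I i x -> exists c : 'I_e -> k, ideal_pow I i.+1 (x - comb c g)) ->
  forall c : 'rV[k]_e, ideal_pow I i.+1 (comb (c 0) g) -> c = 0.
Proof.
move=> [b [hb fb sp]] hg spg c hc.
have [G hG] := dim_quot_coords (fun l => sp _ (hg l)).
have [B hB] := dim_quot_coords (fun l => spg _ (hb l)).
have free (v : 'rV[k]_e) : ideal_pow I i.+1 (comb (v 0) b) -> v = 0.
  by move=> h; apply/rowP => j; rewrite (fb _ h) mxE.
have cG : c *m G = 0.
  apply: free; have -> : comb ((c *m G) 0) b =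
    comb (c 0) g - (comb (c 0) g - comb ((c *m G) 0) b) by rewrite opprB addrC subrK.
  exact: ideal_powB.
have BG : B *m G = 1%:M.
  apply/row_matrixP => j; rewrite rowE; apply/eqP; rewrite -subr_eq0 rowE -mulmxBr; apply/eqP.
  set v := delta_mx 0 j; apply: free.
  have -> : comb ((v *m (B *m G - 1%:M)) 0) b =
      - ((comb (v 0) b - comb ((v *m B) 0) g) +
      (comb ((v *m B) 0) g - comb ((v *m B *m G) 0) b)).
    rewrite mulmxBr mulmx1 mulmxA addrA subrK opprB -sumrB; apply: eq_bigr => l _.
    rewrite -mulrBl; congr (_ * _); apply: (addIr (algmap (v 0 l))).
    by rewrite -algmapD subrK; congr algmap; rewrite mxE [(- v) 0 l]mxE subrK.
  by rewrite -mulN1r; apply: ideal_pow_mull; apply: ideal_powD.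
by rewrite -(mulmx1 c) -(mulmx1C BG) mulmxA cG mul0mx.
Qed.

End LinearAlgebra.

(** * The criterion for membership in Z *)

Section HilbertFunction.
Variable k : fieldType.
Local Notation S := (mseries k 2).
Local Notation cst c := (@ms_const k 2 c).
Implicit Types (s t : S) (f : dpoly k 2).

Definition order2_Ann f := exists s, [/\ s \in Ann f, ord_ge 2 s & form s 2 != 0].

(** The 2x2 minor on columns p and r of the matrix with rows (c_0, ..., c_(d-1)) and (c_1, ...,
    c_d), where c are the coefficients of f_d. Some such minor is nonzero iff the two first-order
    contractions of f_d are independent. *)
Definition top_minor d f p r : k :=
  top d f p * top d f r.+1 - top d f p.+1 * top d f r.

Lemma comb_cls f e (c : 'I_e -> k) (s : 'I_e -> S) :
  \sum_j algmap (c j) * cls f (s j) = cls f (\sum_j cst (c j) * s j).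
Proof. by rewrite rmorph_sum; apply: eq_bigr => j _; rewrite rmorphM. Qed.

Lemma form_comb e (c : 'I_e -> k) (s : 'I_e -> S) n :
  form (\sum_j cst (c j) * s j) n = \sum_j c j *: form (s j) n.
Proof. by rewrite form_sum; apply: eq_bigr => j _; rewrite form_constM. Qed.

Lemma ord_ge_comb i e (c : 'I_e -> k) (s : 'I_e -> S) :
  (forall j, ord_ge i (s j)) -> ord_ge i (\sum_j cst (c j) * s j).
Proof. by move=> h n ni; rewrite form_comb big1 // => j _; rewrite h // scaler0. Qed.

Lemma pair_constM d f c s : pair d f (cst c * s) = c * pair d f s.
Proof. by rewrite /pair mulr_sumr; apply: eq_bigr => u _; rewrite mulrA constM_coef. Qed.

Lemma lam_sum d f (I : Type) (r : seq I) (F : I -> {poly k}) :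
  lam d f (\sum_(i <- r) F i) = \sum_(i <- r) lam d f (F i).
Proof. by apply: (big_morph (lam d f)) => [s t|]; rewrite ?lamD ?lam0. Qed.

Section Fixed.
Variables (d : nat) (f : dpoly k 2) (hf : P_le k d f).
Local Notation cl := (cls f).
Local Notation mpow := (ideal_pow (@max_ideal (Apolar f))).

(** Reduces each Hilbert function value to initial forms. A relation modulo m^(i+1) yields an
    annihilator whose initial form is the combination of those of [s], so [Ann_lam] supplies linear
    equations on the coefficients; spanning only has to be checked on degree-i forms. *)
Lemma dim_quot_forms i e (s : 'I_e -> S) : (1 : Apolar f) <> 0 ->
  (forall j, ord_ge i (s j)) ->
  (forall c : 'I_e -> k, (forall p, (i + p <= d)%N ->
      \sum_j c j * lam d f (form (s j) i * 'X^p) = 0) -> forall j, c j = 0) ->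
  (forall g : {poly k}, (size g <= i.+1)%N -> exists c t,
      [/\ t \in Ann f, ord_ge i t & g = \sum_j c j *: form (s j) i + form t i]) ->
  dim_quot (mpow i) (mpow i.+1) e.
Proof.
move=> nz hs fr sp; exists (fun j => cl (s j)); split=> [j|c|x].
- by apply/(ideal_powP hf) => //; exists (s j).
- rewrite comb_cls => /(ideal_pow_cls hf nz) [t [tA ht]]; apply: fr => p ip.
  have hc := ord_ge_comb c hs.
  have hct : ord_ge i (\sum_j cst (c j) * s j - t).
    by apply: ord_geB => //; apply: ord_ge_leq ht.
  have := Ann_lam hf tA hct ip; rewrite formB form_comb ht // subr0 mulr_suml lam_sum => E.
  by rewrite -[RHS]E; apply: eq_bigr => j _; rewrite -scalerAl lamZ.
move=> /(ideal_powP hf nz) [w [-> hw]].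
have [c [t [tA ht eg]]] := sp _ (size_form w i).
exists c; rewrite comb_cls -rmorphB; apply/(ideal_pow_cls hf nz).
exists (w - (\sum_j cst (c j) * s j) - t); rewrite opprB addrC subrK; split=> //.
have hc := ord_ge_comb c hs.
apply: ord_geS; first by apply: ord_geB => //; exact: ord_geB.
by rewrite !formB form_comb eg -addrA -opprD subrr.
Qed.

Lemma top_minor_hankel p r : (p < d)%N -> (r < d)%N -> top_minor d f p r != 0 ->
  hankel_minor (top d f) d 1.
Proof.
move=> pd rd; rewrite /top_minor subr_eq0 => h; exists 0%N, 1%N, p, r; split; [lia|lia|lia|lia|].
by rewrite !add1n !add0n (mulrC (top d f r)).
Qed.

Lemma hankel_top_neq0 i : (i <= d)%N -> hankel_minor (top d f) d i ->
  exists2 a, (a <= d)%N & top d f a != 0.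
Proof.
move=> id [a [a' [p [p' [h1 h2 h3 h4 ne]]]]].
case: (eqVneq (top d f (a + p)) 0) => [e|]; last by exists (a + p)%N => //; lia.
exists (a + p')%N; first lia.
by apply: contraNneq ne => e'; rewrite e e' !mul0r.
Qed.

Lemma hilbert_of_minor p r : (2 <= d)%N -> order2_Ann f -> (p < d)%N -> (r < d)%N ->
  top_minor d f p r != 0 ->
  has_hilbert_function (Apolar f) (nth 0%N (1 :: rcons (nseq d.-1 2) 1)%N).
Proof.
move=> d2 [q [qA q2 qne]] pd rd mne.
have hk := top_minor_hankel pd rd mne.
have [b bd tb] := hankel_top_neq0 (ltnW d2) hk.
have nz : (1 : Apolar f) <> 0.
  by rewrite -(rmorph1 cl) => /cls0P h; rewrite (Ann1_top hf h bd) eqxx in tb.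
move=> i; have [->|i0] := posnP i.
  apply: (@dim_quot_forms _ _ (fun=> 1)) => // [c h j|g sg].
    have := h b bd; rewrite big_ord_recl big_ord0 addr0 form1 mul1r lamXn //.
    by move/eqP; rewrite mulf_eq0 (negbTE tb) orbF (ord1 j) => /eqP.
  exists (fun=> g`_0), 0; split; [by apply/cls0P; rewrite rmorph0|exact: ord_ge0|].
  rewrite big_ord_recl big_ord0 form0 !addr0 form1 alg_polyC; exact: size1_polyC.
have [id|di] := ltnP i d.
  have -> : nth 0%N (1 :: rcons (nseq d.-1 2) 1)%N i = 2%N.
    by case: i i0 id => // i _ id; rewrite /= nth_rcons size_nseq nth_nseq !ifT //; lia.
  (* The rows of a nonzero minor of the i-th catalecticant give two monomials independent modulo
     annihilators; multiples of the quadric supply the remaining dimensions. *)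
  have [a [a' [x [x' [h1 h2 h3 h4 ne]]]]] := hankel_minor_le (c := top d f) (d := d) (i := i) ltac:(lia) hk.
  have sX c : (c <= i)%N -> (size ('X^c : {poly k}) <= i.+1)%N by rewrite size_polyXn.
  pose s (j : 'I_2) := if j == ord0 then hform i 'X^a : S else hform i 'X^a'.
  have E (c1 c2 : k) y : (i + y <= d)%N -> 
      c1 * lam d f ('X^a * 'X^y) + c2 * lam d f ('X^a' * 'X^y) =
      c1 * top d f (a + y) + c2 * top d f (a' + y).
    by move=> iy; rewrite -!exprD !lamXn //; lia.
  apply: (@dim_quot_forms _ _ s) => // [j|c h|g sg].
  - by rewrite /s; case: ifP => _; apply: ord_ge_hform; exact: sX.
  - have H y : (i + y <= d)%N -> c ord0 * top d f (a + y) + c ord_max * top d f (a' + y) = 0.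
      move=> iy; rewrite -(E _ _ _ iy); have := h y iy.
      rewrite 2!big_ord_recl big_ord0 addr0 /s /= !form_hform ?sX // !eqxx.
      by rewrite (_ : lift ord0 ord0 = ord_max) //; exact: val_inj.
    have [c1 c2] := det2_inj ne (H x ltac:(lia)) (H x' ltac:(lia)).
    move=> j; have : (j == ord0) || (j == ord_max) by case: j => -[|[|]].
    by case/orP => /eqP ->.
  have [j ij] : exists j, i = j.+1 by exists i.-1; lia.
  have sq : (size (form q 2) <= 3)%N := size_form q 2.
  (* The initial quadric times a form of degree i - 2 is the initial form of an annihilator. For i =
     1 only h = 0 is possible. *)
  have qh (h : {poly k}) : (size h <= j)%N ->
      exists t, [/\ t \in Ann f, ord_ge i t & form t i = form q 2 * h].
    case: j ij => [|j] ij sh.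
      exists 0; split; [by apply/cls0P; rewrite rmorph0|exact: ord_ge0|].
      by rewrite form0; move: sh; rewrite leqn0 size_poly_eq0 => /eqP ->; rewrite mulr0.
    have hh := ord_ge_hform sh.
    exists (hform j h * q); split; first exact: ideal_mulr.
      by have := ord_geM hh q2; rewrite addn2 ij.
    by have := form_mul_lead hh q2; rewrite form_hform // eqxx addn2 -ij [h * _]mulrC.
  have sXj c : (c <= i)%N -> (size ('X^c : {poly k}) <= j.+2)%N by rewrite -ij; exact: sX.
  rewrite ij in sg.
  have [|c1 [c2 [h [sh ->]]]] := poly_two_span (sXj a h1) (sXj a' h2) sq qne _ sg.
    move=> c1 c2 h sh e.
    have H y : (i + y <= d)%N -> c1 * top d f (a + y) + c2 * top d f (a' + y) = 0.
      move=> iy; have [t [tA ht ft]] := qh h sh.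
      have := congr1 (fun g => lam d f (g * 'X^y)) e.
      by rewrite /= mul0r lam0 !mulrDl -!scalerAl !lamD !lamZ E // -ft (Ann_lam hf tA ht iy) addr0.
    exact: (det2_inj ne (H x ltac:(lia)) (H x' ltac:(lia))).
  have [t [tA ht ft]] := qh h sh.
  exists (fun l => if l == ord0 then c1 else c2), t; split=> //.
  by rewrite 2!big_ord_recl big_ord0 addr0 /s /= !form_hform ?sX // !eqxx ft.
have [ie|di'] := eqVneq i d.
  have -> : nth 0%N (1 :: rcons (nseq d.-1 2) 1)%N i = 1%N.
    by case: i i0 ie di => // i _ ie di; rewrite /= nth_rcons size_nseq -ie /= ltnn eqxx.
  have [a ad ta] := hankel_top_neq0 (ltnW d2) hk.
  have sX : (size ('X^a : {poly k}) <= i.+1)%N by rewrite size_polyXn ie.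
  have hX := ord_ge_hform sX.
  apply: (@dim_quot_forms _ _ (fun=> hform i 'X^a)) => // [c h j|g sg].
    have := h 0%N ltac:(lia); rewrite big_ord_recl big_ord0 addr0 form_hform // eqxx.
    rewrite expr0 mulr1 lamXn // => /eqP.
    by rewrite mulf_eq0 (negbTE ta) orbF (ord1 j) => /eqP.
  (* Chosen so that [g - c *: 'X^a] pairs to zero with f_d and therefore lifts to an annihilator. *)
  pose c := lam d f g / top d f a.
  have sg' : (size (g - c *: 'X^a)%R <= i.+1)%N.
    by rewrite (leq_trans (size_polyD _ _)) // geq_max sg size_polyN (leq_trans (size_scale_leq _ _)).
  exists (fun=> c), (hform i (g - c *: 'X^a)); split; last first.
  - by rewrite big_ord_recl big_ord0 addr0 !form_hform // eqxx addrC subrK.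
  - exact: ord_ge_hform.
  apply: (lam_Ann hf); first by rewrite -ie; exact: ord_ge_hform.
  by rewrite -ie form_hform // eqxx ie lamD lamN lamZ lamXn // /c divfK // subrr.
have -> : nth 0%N (1 :: rcons (nseq d.-1 2) 1)%N i = 0%N.
  by rewrite nth_default //= size_rcons size_nseq; lia.
apply: (@dim_quot_forms _ _ (fun=> 0)) => // [j|c h [] //|g sg]; first exact: ord_ge0.
have hg := ord_ge_hform sg.
exists (fun=> 0), (hform i g); rewrite big_ord0 add0r form_hform // eqxx; split=> //.
by apply: (ord_Ann hf); apply: ord_ge_leq hg; lia.
Qed.


(** The quadric comes from H(2) <= 2, as three quadratic monomials are then dependent modulo m^3.
    The minor comes from comparing H(d-1) = 2 with H(d) = 1: were all minors zero, m^(d-1)/m^d would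
    have too few independent classes. *)
Lemma hilbert_order2 : (2 <= d)%N ->
  has_hilbert_function (Apolar f) (nth 0%N (1 :: rcons (nseq d.-1 2) 1)%N) ->
  order2_Ann f /\ exists p r, [/\ (p < d)%N, (r < d)%N & top_minor d f p r != 0].
Proof.
move=> d2 H.
have nz : (1 : Apolar f) <> 0.
  move=> e; have [b [_ fr _]] := H 0%N.
  have /eqP := fr (fun=> 1) ltac:(by rewrite -[X in ideal_pow _ _ X]mul1r e mul0r; exact: ideal_pow0) ord0.
  by rewrite oner_eq0.
split.
  pose s (l : 'I_3) : S := hform 2 'X^l.
  have sX (l : 'I_3) : (size ('X^l : {poly k}) <= 3)%N by rewrite size_polyXn ltn_ord.
  have hs l : ord_ge 2 (s l) by exact: ord_ge_hform.
  have H2 : (nth 0%N (1 :: rcons (nseq d.-1 2) 1)%N 2 < 3)%N.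
    by move: d2; case: (d) => [|[|[|n]]].
  have [l|c [c0]] := dim_quot_dep (g := fun l => cl (s l)) (H 2%N) H2.
    by apply/(ideal_powP hf nz); exists (s l).
  rewrite comb_cls => /(ideal_pow_cls hf nz) [t [tA ht]].
  have hc := ord_ge_comb (c 0) hs.
  exists (\sum_j cst (c 0 j) * s j - t); split=> //.
    by apply: ord_geB => //; apply: ord_ge_leq ht.
  apply: contraNneq c0; rewrite formB ht // subr0 form_comb => e; apply/eqP/rowP => l.
  have := congr1 (fun g : {poly k} => g`_l) e.
  rewrite coef0 coef_sum (bigD1 l) //= coefZ form_hform // eqxx coefXn eqxx mulr1.
  rewrite big1 ?addr0 => [->|l' ne]; first by rewrite mxE.
  by rewrite coefZ form_hform // eqxx coefXn [_ == _ :> nat]eq_sym (inj_eq val_inj) (negbTE ne) mulr0.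
apply: contrapT => no.
have V p r : (p < d)%N -> (r < d)%N -> top d f p * top d f r.+1 = top d f p.+1 * top d f r.
  move=> pd rd; apply/eqP; rewrite -subr_eq0; apply/negPn/negP => h; apply: no.
  by exists p, r.
have [m dm] : exists m, d = m.+2 by exists d.-2; lia.
have Hd : nth 0%N (1 :: rcons (nseq d.-1 2) 1)%N d = 1%N.
  by rewrite dm /= nth_rcons size_nseq ltnn eqxx.
have He : nth 0%N (1 :: rcons (nseq d.-1 2) 1)%N m.+1 = 2%N.
  rewrite dm -[LHS]/(nth 0%N (rcons (nseq m.+1 2) 1)%N m).
  by rewrite nth_rcons size_nseq ltnSn nth_nseq ltnSn.
have [z [z_d lz]] : exists z, ord_ge d z /\ lam d f (form z d) = 1.
  have [b [hb fr _]] := H d; rewrite Hd in b hb fr.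
  have /(ideal_powP hf nz) [z [ez hz]] := hb ord0.
  have lz : lam d f (form z d) != 0.
    apply/eqP => e; have /cls0P zA := lam_Ann hf hz e.
    have /eqP := fr (fun=> 1) ltac:(by rewrite big_ord_recl big_ord0 ez zA mulr0 addr0; exact: ideal_pow0) ord0.
    by rewrite oner_eq0.
  exists (cst (lam d f (form z d))^-1 * z); split; first exact: ord_ge_constM.
  by rewrite form_constM lamZ mulVf.
(* If the initial form of s, of degree d - 1, kills f_d, then s contracts f to the constant
   [pair d f s], and so does that multiple of [z], which has order d. *)
have key s : ord_ge m.+1 s -> lam d f (form s m.+1) = 0 -> lam d f (form s m.+1 * 'X) = 0 ->
    exists t, s - t \in Ann f /\ ord_ge m.+2 t.
  move=> hs l0 l1; exists (cst (pair d f s) * z); split; last first.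
    by apply: ord_ge_constM; rewrite -dm.
  apply/(Ann_pairP _ hf) => w; pose w0 := (form w 0)`_0.
  pose w1 : S := w - cst w0.
  have ew : w = cst w0 + w1 by rewrite /w1 addrC subrK.
  have e0 : form w 0 = w0%:P by apply: size1_polyC; exact: size_form.
  have hw1 : ord_ge 1 w1 by move=> [|//] _; rewrite formB form_const e0 subrr.
  have -> : (s - cst (pair d f s) * z) * w =
     cst w0 * s + s * w1 + cst (- pair d f s) * (w * z).
    have -> : cst (- pair d f s) = - cst (pair d f s) by apply/funext => u; exact: mulNr.
    transitivity (s * w - cst (pair d f s) * (w * z)); first by ring.
    by rewrite {1}ew; ring.
  rewrite !pairD !pair_constM.
  have -> : pair d f (s * w1) = 0.
    have := ord_geM hs hw1; have := form_mul_lead hs hw1; rewrite addn1 -dm => fe oe.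
    rewrite pair_lead // fe.
    have -> : form w1 1 = (form w1 1)`_0%N *: 1 + (form w1 1)`_1%N *: 'X.
      apply/polyP => -[|[|n]]; rewrite coefD !coefZ coef1 coefX /= ?mulr1 ?mulr0 ?addr0 ?add0r //.
      by rewrite nth_default // (leq_trans (size_form _ _)).
    by rewrite mulrDr -!scalerAr mulr1 lamD !lamZ l0 l1 !mulr0 addr0.
  have o0 : ord_ge 0 w by [].
  have oz : ord_ge d (w * z) := ord_geM o0 z_d.
  have := form_mul_lead o0 z_d; rewrite add0n (pair_lead _ oz) => ->.
  by rewrite e0 mul_polyC lamZ lz mulr1 addr0 mulNr mulrC subrr.
have [b [hb fr _]] := H m.+1; rewrite He in b hb fr.
have /(ideal_powP hf nz) [s1 [e1 h1]] := hb ord0.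
have /(ideal_powP hf nz) [s2 [e2 h2]] := hb ord_max.
have L0 s : lam d f (form s m.+1) = \sum_(a < d) (form s m.+1)`_a * top d f a.
  by rewrite /lam big_ord_recr /= [X in _ + X * _]nth_default ?dm ?size_form // mul0r addr0.
have L1 s : lam d f (form s m.+1 * 'X) = \sum_(a < d) (form s m.+1)`_a * top d f a.+1.
  rewrite /lam big_ord_recl coefMX /= mul0r add0r; apply: eq_bigr => a _.
  by rewrite coefMX.
(* The two values attached to s are combinations, with the coefficients of its initial form, of the
   pairs (c_a, c_(a+1)). These are pairwise dependent by [V], so the 2x2 determinant vanishes. *)
have [|c1 [c2 [cne [k0 k1]]]] := @det2_kernel k (lam d f (form s1 m.+1)) (lam d f (form s1 m.+1 * 'X))
    (lam d f (form s2 m.+1)) (lam d f (form s2 m.+1 * 'X)).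
  rewrite !L0 !L1 !mulr_suml; apply: eq_bigr => a _.
  rewrite !mulr_sumr; apply: eq_bigr => a' _.
  rewrite mulrACA V ?ltn_ord //; ring.
pose c (l : 'I_2) := if l == ord0 then c1 else c2.
have hc l : c l = 0.
  apply: fr; pose w : S := cst c1 * s1 + cst c2 * s2.
  have -> : \sum_j algmap (c j) * b j = cl w.
    rewrite 2!big_ord_recl big_ord0 addr0 /c /= e1 (_ : lift ord0 ord0 = ord_max); last exact: val_inj.
    by rewrite e2 rmorphD !rmorphM.
  apply/(ideal_pow_cls hf nz); apply: key; first by apply: ord_geD; exact: ord_ge_constM.
    by rewrite formD !form_constM lamD !lamZ.
  by rewrite formD !form_constM mulrDl -!scalerAl lamD !lamZ.
by move: cne; rewrite -[c1]/(c ord0) -[c2]/(c ord_max) !hc eqxx.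
Qed.


End Fixed.

Lemma Z_locusP d f : (2 <= d)%N -> Z_locus k d f <-> [/\ P_le k d f, order2_Ann f &
  exists p r, [/\ (p < d)%N, (r < d)%N & top_minor d f p r != 0]].
Proof.
move=> d2; split=> [[hf /(hilbert_order2 hf d2) []]|[hf hq [p [r [pd rd ne]]]]] //.
by split=> //; exact: (hilbert_of_minor hf d2 hq pd rd ne).
Qed.

End HilbertFunction.

(** * Coordinates on polynomials of degree at most d, and contraction as a matrix *)

Section Coordinates.
Variables (k : fieldType) (d : nat).
Local Notation S := (mseries k 2).
Local Notation n := (affine_dim d).
Local Notation cst c := (@ms_const k 2 c).
Local Notation mi i := (enum_val i : 'X_{1..2 < d.+1}).
Implicit Types (s t : S) (f : dpoly k 2).

Definition dp_row f : 'rV[k]_n := \row_i dp_coords f i.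
Definition dp_of (v : 'rV[k]_n) : dpoly k 2 := \sum_i v 0 i *: dp_monom k (mi i : 'X_{1..2}).

Lemma coef_dp_of v (m : 'X_{1..2}) : dp_coef (dp_of v) m = \sum_i v 0 i * (val (mi i) == m)%:R.
Proof.
rewrite /dp_coef /dp_of raddf_sum /=; apply: eq_bigr => i _.
by rewrite mcoeffZ mcoeffX.
Qed.

Lemma dp_of_le v : P_le k d (dp_of v).
Proof.
move=> m; rewrite coef_dp_of; apply: contraNT; rewrite -ltnNge => dm.
rewrite big1 // => i _; case: eqP => [e|]; last by rewrite mulr0.
by move: dm; rewrite -e ltnNge -ltnS bmdeg.
Qed.

Lemma dp_coords_of v i : dp_coords (dp_of v) i = v 0 i.
Proof.
rewrite /dp_coords coef_dp_of (bigD1 i) //= eqxx mulr1 big1 ?addr0 // => j ne.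
by rewrite (inj_eq val_inj) (inj_eq enum_val_inj) (negbTE ne) mulr0.
Qed.

Lemma dp_row_of v : dp_row (dp_of v) = v.
Proof. by apply/rowP => i; rewrite mxE dp_coords_of. Qed.

Definition coord (m : 'X_{1..2}) : {mpoly k[n]} :=
  if insub m is Some u then 'X_(enum_rank (u : 'X_{1..2 < d.+1})) else 0.

Lemma coordE f m : (mdeg m <= d)%N -> (coord m).@[dp_coords f] = dp_coef f m.
Proof.
rewrite -ltnS => dm; rewrite /coord insubT mevalXU /dp_coords enum_rankK.
by rewrite SubK.
Qed.

Definition mono (m : 'X_{1..2}) : S := fun u => (u == m)%:R.

Lemma sum_coef (I : Type) (r : seq I) (F : I -> S) u :
  (\sum_(i <- r) F i) u = \sum_(i <- r) F i u.
Proof. by apply: (big_morph (fun s : S => s u)). Qed.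

Lemma pair_coords f s : pair d f s = \sum_i dp_coords f i * s (mi i).
Proof.
rewrite /pair (reindex (fun i : 'I_n => enum_val i)); last exact: onW_bij (enum_val_bij _).
by apply: eq_bigr => i _; rewrite mulrC.
Qed.

(* The matrix, on row vectors, of the contraction by s on P_<=d; on column *)
(* vectors it is multiplication by s on S / m^(d+1).                       *)
Definition contr_mx s : 'M[k]_n := \matrix_(i, j) (s * mono (mi j)) (mi i).

Definition series_of (w : 'cV[k]_n) : S := \sum_j cst (w j 0) * mono (mi j).

Lemma contr_mx_row f s j : (dp_row f *m contr_mx s) 0 j = pair d f (s * mono (mi j)).
Proof. by rewrite mxE pair_coords; apply: eq_bigr => i _; rewrite !mxE. Qed.

Lemma contr_mx_col s (w : 'cV[k]_n) i : (contr_mx s *m w) i 0 = (s * series_of w) (mi i).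
Proof.
rewrite mxE /series_of mulr_sumr sum_coef; apply: eq_bigr => j _.
by rewrite mulrCA constM_coef !mxE mulrC.
Qed.

Lemma contr_mxD s t : contr_mx (s + t) = contr_mx s + contr_mx t.
Proof. by apply/matrixP => i j; rewrite !mxE mulrDl. Qed.

Lemma contr_mxZ c s : contr_mx (cst c * s) = c *: contr_mx s.
Proof. by apply/matrixP => i j; rewrite !mxE -mulrA constM_coef. Qed.

Lemma Ann_contr_mx f s : P_le k d f -> (s \in Ann f) <-> dp_row f *m contr_mx s = 0.
Proof.
move=> hf; rewrite (Ann_pairP _ hf); split=> [h|h w].
  by apply/rowP => j; rewrite contr_mx_row h mxE.
(* Only the truncation of w to degree at most d matters: the remainder lies in m^(d+1) and pairs to
   zero with f. *)
pose w0 := series_of (\col_j w (mi j)).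
have -> : w = w0 + (w - w0) by rewrite addrC subrK.
rewrite mulrDr pairD [X in _ + X]pair_ord ?addr0; last first.
  have s0 : ord_ge 0 s by [].
  have : ord_ge d.+1 (w - w0).
    apply: ord_geP => m dm; rewrite -[LHS]/(w m - w0 m) /w0 /series_of sum_coef.
    have e : m = mi (enum_rank (BMultinom dm)) by rewrite enum_rankK.
    rewrite (bigD1 (enum_rank (BMultinom dm))) //= constM_coef /mono -e eqxx mulr1 mxE -e.
    rewrite big1 ?addr0 ?subrr // => j ne; rewrite constM_coef {1}e (inj_eq val_inj).
    by rewrite (inj_eq enum_val_inj) eq_sym (negbTE ne) mulr0.
  by move=> h'; have := ord_geM s0 h'.
rewrite /w0 /series_of mulr_sumr (big_morph (pair d f) (pairD d f) (id1 := 0)); last first.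
  by apply: pair_ord; exact: ord_ge0.
by rewrite big1 // => j _; rewrite mulrCA pair_constM -contr_mx_row h [X in _ * X]mxE mulr0.
Qed.

Lemma ord_ge_cancel i j s (w : S) : ord_ge i s -> form s i != 0 -> ord_ge (i + j) (s * w) -> ord_ge j w.
Proof.
move=> hs s0 h; elim: j h => [//|j IH] h.
have hw : ord_ge j w by apply: IH; apply: ord_ge_leq h; rewrite leq_add2l.
apply: ord_geS => //; apply/eqP; have := h (i + j)%N ltac:(lia).
by rewrite (form_mul_lead hs hw) => /eqP; rewrite mulf_eq0 (negbTE s0).
Qed.

(* Multiplication by s on S / m^(d+1) has kernel m^(d-1) / m^(d+1) as soon as *)
(* s has order exactly 2, so dually the images of all such contractions agree. *)
Lemma contr_mx_sub s t : (2 <= d)%N -> ord_ge 2 s -> form s 2 != 0 -> ord_ge 2 t ->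
  (contr_mx t <= contr_mx s)%MS.
Proof.
move=> d2 hs s0 ht; rewrite submxE; apply/eqP/matrixP => i j; set C := cokermx _; pose w := col j C.
have -> : (contr_mx t *m C) i j = (contr_mx t *m w) i 0 by rewrite /w colE mulmxA -colE [RHS]mxE.
have sw : contr_mx s *m w = 0 by rewrite /w colE mulmxA mulmx_coker mul0mx.
have e : (2 + d.-1)%N = d.+1 by lia.
have hw : ord_ge d.-1 (series_of w).
  apply: (ord_ge_cancel hs s0); rewrite e; apply: ord_geP => m dm.
  have -> : m = mi (enum_rank (BMultinom dm)) by rewrite enum_rankK.
  by rewrite -contr_mx_col sw mxE.
rewrite contr_mx_col mxE (ord_ge_coef (i := d.+1)) ?bmdeg //.
by rewrite -e; exact: ord_geM.
Qed.


End Coordinates.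

(** * Polynomial paths and irreducibility of Z *)

Section Irreducible.
Variables (k : closedFieldType) (d : nat).
Local Notation n := (affine_dim d).
Local Notation cst c := (@ms_const k 2 c).

Lemma horner_mmap (p : {mpoly k[n]}) (v : 'I_n -> {poly k}) t :
  (mmap (polyC : k -> {poly k}) v p).[t] = p.@[fun i => (v i).[t]].
Proof.
rewrite /mmap mevalE horner_sum; apply: eq_bigr => m _.
rewrite hornerM hornerC /mmap1 horner_prod; congr (_ * _).
by apply: eq_bigr => i _; rewrite horner_exp.
Qed.

Lemma adj1 m : \adj (1%:M : 'M[k]_m) = 1%:M.
Proof. by rewrite -[LHS]mul1mx mul_mx_adj det1. Qed.

(* If N T1 = T2 - T1, then f adj(1 + t N) lies in the kernel of (1-t) T1 + t T2 *)
(* as soon as f T1 = 0; this moves f polynomially along the pencil.             *)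
Lemma adj_pencil m (f : 'rV[k]_m) (T1 T2 N : 'M[k]_m) t :
  f *m T1 = 0 -> N *m T1 = T2 - T1 ->
  f *m \adj (1%:M + t *: N) *m ((1 - t) *: T1 + t *: T2) = 0.
Proof.
move=> fT NT; have -> : (1 - t) *: T1 + t *: T2 = (1%:M + t *: N) *m T1.
  by rewrite mulmxDl mul1mx -scalemxAl NT scalerBl scale1r scalerBr addrAC addrA.
by rewrite mulmxA -(mulmxA f) mul_adj_mx mul_mx_scalar -scalemxAl fT scaler0.
Qed.

Local Notation PM := (map_mx (@polyC k)).

Lemma row_horner m (u v : {poly k}) (A B : 'rV[{poly k}]_m) t :
  \row_i ((u *: A + v *: B) 0 i).[t] =
  u.[t] *: map_mx (horner_eval t) A + v.[t] *: map_mx (horner_eval t) B.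
Proof. by apply/rowP => i; rewrite !mxE /horner_eval !hornerE. Qed.

Lemma horner_adj_pencil m (f : 'rV[k]_m) (N : 'M[k]_m) (u : {poly k}) t :
  map_mx (horner_eval t) (PM f *m \adj (1%:M + u *: PM N)) = f *m \adj (1%:M + u.[t] *: N).
Proof.
have PK a b (B : 'M[k]_(a, b)) : map_mx (horner_eval t) (PM B) = B.
  by apply/matrixP => i j; rewrite !mxE /horner_eval hornerC.
by rewrite map_mxM map_mx_adj map_mxD map_mxZ map_mx1 !PK.
Qed.

(** Equality of row spaces provides N and M with N T1 = T2 - T1 and M T2 = T1 - T2. Adjugates
    replace inverses, so each endpoint moves polynomially inside the kernels of the pencil for every
    t. *)
Lemma path_in_pencil m (f1 f2 : 'rV[k]_m) (T1 T2 : 'M[k]_m) :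
  f1 *m T1 = 0 -> f2 *m T2 = 0 -> (T1 <= T2)%MS -> (T2 <= T1)%MS ->
  exists F : 'I_m -> {poly k},
    [/\ forall i, (F i).[0] = f1 0 i, forall i, (F i).[1] = f2 0 i &
        forall t, (\row_i (F i).[t]) *m ((1 - t) *: T1 + t *: T2) = 0].
Proof.
move=> h1 h2 T12 T21.
have [N NT] : exists N, N *m T1 = T2 - T1.
  exists ((T2 - T1) *m pinvmx T1); rewrite mulmxKpV // addmx_sub //.
  by rewrite (eqmx_opp T1) submx_refl.
have [M MT] : exists M, M *m T2 = T1 - T2.
  exists ((T1 - T2) *m pinvmx T2); rewrite mulmxKpV // addmx_sub //.
  by rewrite (eqmx_opp T2) submx_refl.
(* One path starts at [f1], the other ends at [f2]. For each t both lie in the same kernel, so their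
   interpolation does too, and the weights fix the endpoints because the adjugate of 1 is 1. *)
pose F : 'rV[{poly k}]_m := (1 - 'X) *: (PM f1 *m \adj (1%:M + 'X *: PM N)) +
  'X *: (PM f2 *m \adj (1%:M + (1 - 'X) *: PM M)).
have FE t : \row_i (F 0 i).[t] = (1 - t) *: (f1 *m \adj (1%:M + t *: N)) +
    t *: (f2 *m \adj (1%:M + (1 - t) *: M)).
  by rewrite /F row_horner 2!horner_adj_pencil hornerX hornerD hornerN hornerX hornerC.
have Fi i t : (F 0 i).[t] = (\row_i (F 0 i).[t]) 0 i by rewrite mxE.
exists (F 0); split=> [i|i|t].
- by rewrite Fi FE subr0 !scale0r !addr0 adj1 mulmx1 scale1r.
- by rewrite Fi FE subrr !scale0r add0r addr0 adj1 mulmx1 scale1r.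
rewrite FE mulmxDl -!scalemxAl adj_pencil // scaler0 add0r.
have := adj_pencil (1 - t) h2 MT; rewrite (_ : 1 - (1 - t) = t); last by ring.
by rewrite [(1 - t) *: T1 + _]addrC => ->; rewrite scaler0.
Qed.

Lemma order2_Ann_path f1 f2 : (2 <= d)%N -> P_le k d f1 -> P_le k d f2 ->
  order2_Ann f1 -> order2_Ann f2 ->
  exists (F : 'I_n -> {poly k}) (p : {poly k}), [/\ p != 0,
    forall i, (F i).[0] = dp_coords f1 i, forall i, (F i).[1] = dp_coords f2 i &
    forall t, ~~ root p t -> order2_Ann (dp_of (\row_i (F i).[t]))].
Proof.
move=> d2 hf1 hf2 [s1 [A1 o1 q1]] [s2 [A2 o2 q2]].
have [F [F0 F1 Ft]] := path_in_pencil (proj1 (Ann_contr_mx _ hf1) A1) (proj1 (Ann_contr_mx _ hf2) A2)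
   (contr_mx_sub d2 o2 q2 o1) (contr_mx_sub d2 o1 q1 o2).
pose a := (size (form s1 2)).-1.
(* The coefficient of the pencil's quadric at the leading index [a] of the first quadric: it is
   nonzero at t = 0, and where it is nonzero the pencil has order exactly two. *)
pose p : {poly k} := (1 - 'X) * ((form s1 2)`_a)%:P + 'X * ((form s2 2)`_a)%:P.
have pE t : p.[t] = (1 - t) * (form s1 2)`_a + t * (form s2 2)`_a by rewrite /p !hornerE.
exists F, p; split.
- apply/eqP => p0; have := pE 0; rewrite p0 horner0 subr0 mul1r mul0r addr0 => /eqP.
  by rewrite eq_sym lead_coef_eq0 (negbTE q1).
- by move=> i; rewrite F0 mxE.
- by move=> i; rewrite F1 mxE.
move=> t pt; exists (cst (1 - t) * s1 + cst t * s2); split.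
- apply: (proj2 (Ann_contr_mx _ (@dp_of_le k d _))); rewrite dp_row_of contr_mxD !contr_mxZ; exact: Ft.
- by apply: ord_geD; exact: ord_ge_constM.
apply: contraNneq pt; rewrite formD !form_constM => e; apply/rootP; rewrite pE.
by rewrite -!coefZ -coefD e coef0.
Qed.

Definition minor_poly p r : {mpoly k[n]} :=
  coord k d (mon p (d - p)) * coord k d (mon r.+1 (d - r.+1)) -
  coord k d (mon p.+1 (d - p.+1)) * coord k d (mon r (d - r)).

Lemma minor_polyE p r f : (p < d)%N -> (r < d)%N ->
  (minor_poly p r).@[dp_coords f] = top_minor d f p r.
Proof.
move=> pd rd; rewrite /minor_poly mevalB !mevalM.
by rewrite !coordE ?mdeg_mon ?subnKC //; exact: ltnW.
Qed.

Lemma Z_locus_irreducible : (2 <= d)%N -> (Z_locus k d !=set0)%classic -> zariski_irreducible d (Z_locus k d).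
Proof.
move=> d2 ne; split=> // _ _ [E1 ->] [E2 ->] hVW.
apply: contrapT => /not_orP[/existsNP[f1 /not_implyP[Z1 n1]] /existsNP[f2 /not_implyP[Z2 n2]]].
have ex (E : set {mpoly k[n]}) f : P_le k d f ->
    ~ (P_le k d `&` [set f | forall p, E p -> p.@[dp_coords f] = 0])%classic f ->
    exists2 p, E p & p.@[dp_coords f] != 0.
  move=> hf h; apply: contrapT => h'; apply: h; split=> // p Ep.
  by apply/eqP/negPn/negP => h2; apply: h'; exists p.
have [hf1 ha1 [p [r [pd rd m1]]]] := proj1 (Z_locusP f1 d2) Z1.
have [hf2 ha2 _] := proj1 (Z_locusP f2 d2) Z2.
have [p1 E1p e1] := ex _ _ hf1 n1.
have [p2 E2p e2] := ex _ _ hf2 n2.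
have [F [g [g0 F0 F1 Ft]]] := order2_Ann_path d2 hf1 hf2 ha1 ha2.
have hF (q : {mpoly k[n]}) t f : (forall i, (F i).[t] = dp_coords f i) ->
    (mmap (polyC : k -> {poly k}) F q).[t] = q.@[dp_coords f].
  by move=> h; rewrite horner_mmap; apply: meval_eq.
have nz (q : {mpoly k[n]}) t f : (forall i, (F i).[t] = dp_coords f i) ->
    q.@[dp_coords f] != 0 -> mmap (polyC : k -> {poly k}) F q != 0.
  by move=> h; rewrite -(hF _ _ _ h); apply: contraNneq => ->; rewrite horner0.
(* Each factor is a nonzero polynomial in t because it is nonzero at t = 0 or t = 1, or is the
   excluded locus [g]. A non-root of the product exists over an algebraically closed field. *)
have := mulf_neq0 (mulf_neq0 (nz _ _ _ F0 e1) (nz _ _ _ F1 e2))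
         (mulf_neq0 g0 (nz (minor_poly p r) 0 f1 F0 ltac:(by rewrite minor_polyE))).
move=> /closed_nonrootP[t]; rewrite !rootM !negb_or => /andP[/andP[r1 r2] /andP[rg rm]].
pose f := dp_of (\row_i (F i).[t]).
have Ff i : (F i).[t] = dp_coords f i by rewrite dp_coords_of mxE.
rewrite /root !(hF _ _ _ Ff) in r1 r2 rm.
have : Z_locus k d f.
  apply/(Z_locusP _ d2); split; [exact: dp_of_le|exact: Ft|].
  by exists p, r; split=> //; rewrite -minor_polyE.
by move=> /hVW [[_ /(_ _ E1p)]|[_ /(_ _ E2p)]] /eqP; apply/negP.
Qed.

Definition fermat : dpoly k 2 := dp_monom k (mon d 0) + dp_monom k (mon 0 d).

Lemma fermat_coef m : dp_coef fermat m = (mon d 0 == m)%:R + (mon 0 d == m)%:R.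
Proof. by rewrite /dp_coef /fermat mcoeffD !mcoeffX. Qed.

Lemma top_fermat a : (0 < d)%N -> (a <= d)%N -> top d fermat a = ((a == 0%N) || (a == d))%:R.
Proof.
move=> d0 ad; rewrite /top fermat_coef ![_ == mon a _]eq_sym !monP !mdeg_mon !mon0E.
rewrite subnKC // addn0 add0n !eqxx !andbT.
by case: (eqVneq a 0%N) => [->|_]; [rewrite eq_sym (gtn_eqF d0) add0r|rewrite addr0].
Qed.

Lemma Z_locus_fermat : (2 <= d)%N -> Z_locus k d fermat.
Proof.
move=> d2; have hf : P_le k d fermat.
  move=> m; rewrite fermat_coef.
  case: (eqVneq (mon d 0) m) => [<-|_]; first by rewrite mdeg_mon addn0.
  case: (eqVneq (mon 0 d) m) => [<-|_]; first by rewrite mdeg_mon add0n.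
  by rewrite addr0 eqxx.
have s3 : (size ('X : {poly k}) <= 3)%N by rewrite size_polyX.
apply/(Z_locusP _ d2); split=> //.
  (* The degree-2 form dehomogenising to ['X] is alpha beta, which kills both x^[d] and y^[d]. *)
  exists (hform 2 'X); split; [|exact: ord_ge_hform|by rewrite form_hform // eqxx polyX_eq0].
  apply/(AnnP _ (leqnn _)) => m; apply: big1 => u _; rewrite /hform coefX.
  case: eqP => [u2|]; last by rewrite mul0r.
  case: eqP => [u1|]; last by rewrite mul0r.
  rewrite fermat_coef mul1r ![_ == (m + u)%MM]eq_sym !monP mdegD mnmDE mdeg2 u1 u2.
  set a := m ord0; set b := m ord_max; clearbody a b.
  have -> : ((a + 1 == d) && (a + b + 2 == d + 0) = false)%N by lia.
  have -> : ((a + 1 == 0) && (a + b + 2 == 0 + d) = false)%N by lia.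
  exact: addr0.
exists 0%N, d.-1; split; try lia.
rewrite /top_minor prednK ?(ltnW d2) // !top_fermat; try lia.
rewrite !eqxx /= orbT mul1r (_ : (1 == d)%N = false) ?mul0r ?subr0 ?oner_eq0 //; lia.
Qed.

End Irreducible.

(** * A grading that splits the m-adic filtration gives an isomorphism with gr *)

Section SplitFiltration.
Variables (k : fieldType) (A : comPzAlgType k).
Local Notation mpow := (ideal_pow (@max_ideal A)).

Lemma ideal_pow_leq (I : set A) i j x : (i <= j)%N -> ideal_pow I j x -> ideal_pow I i x.
Proof.
move=> ij; rewrite -(subnK ij); elim: (j - i)%N x => [//|l IH] x [n [a [b [h ->]]]].
by apply: ideal_pow_sum => l'; rewrite mulrC; apply: ideal_pow_mull; apply: IH; case: (h l').
Qed.

Variables (D : nat) (G : nat -> set A).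
Hypotheses (G1 : G 0%N 1) (Gc : forall c, G 0%N (algmap c)).
Hypotheses (GB : forall i x y, G i x -> G i y -> G i (x - y)).
Hypotheses (GM : forall i j x y, G i x -> G j y -> G (i + j)%N (x * y)).
Hypotheses (Gle : forall i x, G i x -> mpow i x).
Hypotheses (Gspan : forall i x, mpow i x -> exists2 y, G i y & mpow i.+1 (x - y)).
Hypotheses (Gfree : forall i x, G i x -> mpow i.+1 x -> x = 0).
Hypotheses (mD : forall x, mpow D x -> x = 0).

Let G0 i : G i 0.
Proof.
have [y Gy _] := Gspan (ideal_pow0 (@max_ideal A) i).
by rewrite -(subrr y); exact: GB.
Qed.

Let GD i x y : G i x -> G i y -> G i (x + y).
Proof. by move=> hx hy; rewrite -[y]opprK -[- y]sub0r; apply: GB => //; apply: GB. Qed.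

Let Gsum i (T : finType) (F : T -> A) : (forall t, G i (F t)) -> G i (\sum_t F t).
Proof. by move=> h; apply: big_ind => //; exact: GD. Qed.

Let GDz i x : (D <= i)%N -> G i x -> x = 0.
Proof. by move=> h /Gle /(ideal_pow_leq h) /mD. Qed.

Let dec_ex x : exists F : nat -> A, (forall i, G i (F i)) /\ x = \sum_(i < D) F i.
Proof.
have [F [hF hx]] : exists F : nat -> A, (forall i, G i (F i)) /\ mpow D (x - \sum_(i < D) F i).
  elim: D => [|n [F [hF hx]]]; first by exists (fun=> 0).
  have [y Gy hy] := Gspan hx.
  exists (fun i => if i == n then y else F i); split=> [i|]; first by case: eqP => [->|].
  rewrite big_ord_recr /= eqxx opprD addrA.
  rewrite (eq_bigr (fun i : 'I_n => F i)) // => i _.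
  by rewrite (ltn_eqF (ltn_ord i)).
by exists F; split=> //; apply/eqP; rewrite -subr_eq0; apply/eqP; exact: mD.
Qed.

(** Induction on i: once lower differences vanish, the i-th one equals minus the sum of the higher
    ones, so it lies in m^(i+1) and is zero by [Gfree]. *)
Let dec_uniq (F F' : nat -> A) : (forall i, G i (F i)) -> (forall i, G i (F' i)) ->
  \sum_(i < D) F i = \sum_(i < D) F' i -> F = F'.
Proof.
move=> hF hF' /eqP; rewrite -subr_eq0 -sumrB => /eqP e.
suff H i : F i - F' i = 0 by apply/funext => i; apply/eqP; rewrite -subr_eq0 H.
have GE j : G j (F j - F' j) by exact: GB.
elim/ltn_ind: i => i IH; case: (leqP D i) => iD; first exact: GDz iD _.
apply: Gfree => //; move: e; rewrite (bigD1 (Ordinal iD)) //= => /eqP.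
rewrite addr_eq0 => /eqP ->; rewrite -mulN1r; apply: (@ideal_pow_mull _ _ i.+1).
apply: (big_ind (mpow i.+1)) => [||j ne]; [exact: ideal_pow0|exact: ideal_powD|].
case: (ltnP i j) => ij; first exact: ideal_pow_leq ij (Gle (GE _)).
rewrite IH; first exact: (@ideal_pow0 _ _ i.+1).
by rewrite ltn_neqAle ij andbT.
Qed.

Let dec (x : A) : tseries A := projT1 (cid (dec_ex x)).

Let decG x i : G i (dec x i).
Proof. by rewrite /dec; case: cid => F []. Qed.

Let decE x : x = \sum_(i < D) dec x i.
Proof. by rewrite /dec; case: cid => F []. Qed.

Let decP x (F : nat -> A) : (forall i, G i (F i)) -> x = \sum_(i < D) F i -> dec x = F.
Proof. by move=> hF e; apply: dec_uniq => //; rewrite -e -decE. Qed.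

Let dec_rees x : dec x \in @rees_pred _ A.
Proof.
apply/rees_predP; split=> [i|]; first exact: Gle.
by exists D => i Di; exact: GDz Di _.
Qed.

Let dec_const x : G 0%N x -> dec x = ts_const x.
Proof.
move=> Gx; apply: decP => [[|i] //|].
(* If D = 0 the empty sum must equal x; this holds because m^0 is the whole algebra, which is then
   zero. *)
case: D mD => [h|n _]; last by rewrite big_ord_recl big1 ?addr0.
by rewrite big_ord0; exact: h.
Qed.

Let decD x y : dec (x + y) = dec x + dec y.
Proof.
apply: decP => [i|]; first exact: GD.
by rewrite [LHS](congr2 +%R (decE x) (decE y)) -big_split.
Qed.

(** Products of components with i + j >= D vanish, so the square of index pairs may be cut to a
    triangle and regrouped by total degree, as in the product of the Rees algebra. *)
Let decM x y : dec (x * y) = dec x * dec y.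
Proof.
apply: decP => [i|].
  by apply: Gsum => j; rewrite -[X in G X](@subnKC j) ?leq_ord //; exact: GM.
rewrite [LHS](congr2 *%R (decE x) (decE y)).
have Z i j : (D <= i + j)%N -> dec x i * dec y j = 0 by move=> h; apply: (GDz h); apply: GM.
set F := dec x; set F' := dec y.
transitivity (\sum_(i < D) \sum_(j < D) F i * F' j).
  by rewrite mulr_suml; apply: eq_bigr => i _; rewrite mulr_sumr.
transitivity (\sum_(i < D) \sum_(l < D | (i <= l)%N) F i * F' (l - i)%N); last first.
  rewrite (exchange_big_dep predT) //=; apply: eq_bigr => l _.
  have lD : (l.+1 <= D)%N := ltn_ord l.
  rewrite -[RHS]/(\sum_(j < l.+1) F j * F' (l - j)%N).
  rewrite (big_ord_widen_cond D xpredT (fun j => F j * F' (l - j)%N) lD) /=.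
  by apply: eq_bigl => j; rewrite ltnS.
apply: eq_bigr => i _.
rewrite -(big_mkord xpredT (fun j => F i * F' j)) /=.
rewrite -(big_mkord (fun l => (i <= l)%N) (fun l => F i * F' (l - i)%N)) /=.
have iD : (i <= D)%N := ltnW (ltn_ord i).
rewrite [RHS](big_cat_nat (leq0n i) iD) //= [X in _ = X + _]big_nat_cond [X in _ = X + _]big_pred0; last first.
  by move=> l; apply/negbTE/negP => /= /andP[h1 h2]; move: h1; rewrite ltnNge h2.
rewrite add0r [LHS](big_cat_nat (leq0n (D - i)) (leq_subr _ _)) /=.
rewrite [X in _ + X]big_nat_cond [X in _ + X]big1 ?addr0; last first.
  by move=> j /andP[/andP[h1 _] _]; apply: Z; rewrite -leq_subLR.
have := big_addn 0 D i (fun l => (i <= l)%N) (fun l => F i * F' (l - i)%N).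
rewrite add0n => -> /=; rewrite [RHS]big_mkcond /=; apply: eq_bigr => j _.
by rewrite addnK leq_addl.
Qed.

Let phi x : gr A := (\pi_(alg_quot (@rees_ideal k A)) (Rees (dec_rees x)))%qT.

Let phiE x (r : rees A) : rees_val r = dec x -> phi x = (\pi_(alg_quot (@rees_ideal k A)) r)%qT.
Proof. by move=> e; congr (\pi_(alg_quot _) _)%qT; apply: val_inj. Qed.

(** The map records homogeneous components in the Rees algebra and reduces them. [Gfree] makes it
    injective; [Gspan], applied in each degree to a representative, makes it surjective. *)
Lemma split_filtration_gr : alg_isomorphic A (gr A).
Proof.
have phiD : nmod_morphism phi.
  have hD x y : phi (x + y) = phi x + phi y.
    by rewrite -[RHS]pi_algD; apply: phiE; rewrite decD.
  by split=> //; apply: (addrI (phi 0)); rewrite -hD !addr0.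
have phiM : monoid_morphism phi.
  split; last by move=> x y; rewrite -[RHS]pi_algM; apply: phiE; rewrite decM.
  by apply: phiE; rewrite dec_const.
pose aD := GRing.isNmodMorphism.Build A (gr A) phi phiD.
pose aM := GRing.isMonoidMorphism.Build A (gr A) phi phiM.
pose phiR : {rmorphism A -> gr A} := HB.pack phi aD aM.
exists phiR; split; last by move=> c; apply: phiE; rewrite dec_const.
have inj x y : phi x = phi y -> x = y.
  move=> /alg_quot_eqP /asboolP h.
  rewrite (decE x) (decE y); apply: eq_bigr => i _; apply/eqP; rewrite -subr_eq0; apply/eqP.
  by apply: (Gfree (i := i)); [exact: GB | exact: h].
have sur u : exists x, phi x = u.
  have [r hr] : exists r, u = (\pi_(alg_quot (@rees_ideal k A)) r)%qT by exists (repr u); rewrite reprK.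
  have /rees_predP[rm _] := rees_valP r.
  have [F hF] := boolp.choice (fun i => (let: ex_intro2 y a b := Gspan (rm i) in
    ex_intro (fun y => G i y /\ mpow i.+1 (rees_val r i - y)) y (conj a b))).
  exists (\sum_(i < D) F i); rewrite hr.
  have e : dec (\sum_(i < D) F i) = F by apply: decP => // i; case: (hF i).
  apply/alg_quot_eqP/asboolP => i; rewrite -[X in mpow _ X]/(dec (\sum_(i < D) F i) i - rees_val r i) e.
  by rewrite -opprB -mulN1r; apply: ideal_pow_mull; case: (hF i).
have [g hg] := boolp.choice sur.
by exists g => x //=; apply: inj; rewrite hg.
Qed.

End SplitFiltration.

Lemma comb2 (k : pzRingType) (A : comPzAlgType k) (c : 'I_2 -> k) (u v : A) :
  \sum_l algmap (c l) * (if l == ord0 then u else v) =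
  algmap (c ord0) * u + algmap (c ord_max) * v.
Proof.
rewrite 2!big_ord_recl big_ord0 addr0 /= (_ : lift ord0 ord0 = ord_max) //.
exact: val_inj.
Qed.

Section PowersSpan.
Variables (k : fieldType) (A : comPzAlgType k) (x y : A).

Definition powers_span i : set A :=
  fun z => exists c e : k, z = algmap c * x ^+ i + algmap e * y ^+ i.

Lemma powers_span_const c : powers_span 0 (algmap c).
Proof. by exists c, 0; rewrite algmap0 mul0r addr0 mulr1. Qed.

Lemma powers_spanB i z z' : powers_span i z -> powers_span i z' -> powers_span i (z - z').
Proof.
have aN (c : k) : algmap (- c) = - algmap c :> A.
  by apply: (addrI (algmap c)); rewrite -algmapD !subrr algmap0.
move=> [c [e ->]] [c' [e' ->]]; exists (c - c'), (e - e').
by rewrite !algmapD !aN; ring.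
Qed.

(** Mixed terms contain xy. In degree 0 both generators are 1, so there the two coefficients merge
    into one scalar. *)
Lemma powers_spanM i j z z' : x * y = 0 ->
  powers_span i z -> powers_span j z' -> powers_span (i + j) (z * z').
Proof.
move=> xy [c [e ->]] [c' [e' ->]].
case: i => [|i].
  by exists ((c + e) * c'), ((c + e) * e'); rewrite add0n !algmapM !algmapD !expr0; ring.
case: j => [|j].
  exists (c * (c' + e')), (e * (c' + e')); rewrite addn0 !algmapM !algmapD !expr0.
  by move: (x ^+ i.+1) (y ^+ i.+1) => u v; ring.
exists (c * c'), (e * e'); rewrite !algmapM !exprD.
transitivity (algmap c * algmap c' * (x ^+ i.+1 * x ^+ j.+1) + algmap e * algmap e' * (y ^+ i.+1 * y ^+ j.+1)
  + (x * y) * (algmap c * algmap e' * x ^+ i * y ^+ j + algmap e * algmap c' * y ^+ i * x ^+ j)).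
  by rewrite !exprS; move: (x ^+ i) (y ^+ i) (x ^+ j) (y ^+ j) => u v u' v'; ring.
by rewrite xy mul0r addr0.
Qed.

End PowersSpan.

(** * The case where the initial quadric has two distinct linear factors *)

Section Distinct.
Variable k : fieldType.
Local Notation S := (mseries k 2).
Local Notation cst c := (@ms_const k 2 c).

Section LinearForms.
Variables (l1 l2 : {poly k}).
Hypotheses (sl1 : (size l1 <= 2)%N) (sl2 : (size l2 <= 2)%N).
Hypothesis D0 : l1`_0 * l2`_1 - l1`_1 * l2`_0 != 0.

Let linE (l : {poly k}) : (size l <= 2)%N -> l = (l`_0)%:P + (l`_1)%:P * 'X.
Proof.
move=> sl; apply/polyP => -[|[|i]]; rewrite coefD coefC coefMX /= ?coefC ?addr0 ?add0r //.
by rewrite nth_default // (leq_trans sl).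
Qed.

Let sizeM (l u : {poly k}) n : (size l <= 2)%N -> (size u <= n)%N -> (size (l * u)%R <= n.+1)%N.
Proof. by move=> h1 h2; have := size_polyMleq l u; move: h1 h2; clear; lia. Qed.

(** [D0] says that l1 and l2 are not proportional. Cramer's rule then writes alpha and beta as
    combinations of them, hence every form of positive degree. *)
Lemma linear_forms_split n (g : {poly k}) : (0 < n)%N -> (size g <= n.+1)%N ->
  exists u v : {poly k}, [/\ (size u <= n)%N, (size v <= n)%N & g = l1 * u + l2 * v].
Proof.
move=> n0 sg; pose D := l1`_0 * l2`_1 - l1`_1 * l2`_0; have nzD : D != 0 := D0.
pose g1 : {poly k} := \poly_(i < n) g`_i.+1.
have gE : g = g1 * 'X + (g`_0)%:P.
  apply/polyP => -[|i]; rewrite coefD coefMX coefC /= ?add0r // addr0 coef_poly.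
  by case: ltnP => // h; rewrite nth_default // (leq_trans sg).
have s1 : (size g1 <= n)%N by exact: size_poly.
have s0 (c : k) : (size c%:P <= n)%N by rewrite (leq_trans (size_polyC_leq1 _)).
have sZ (c : k) : (size (c *: g1)%R <= n)%N by rewrite (leq_trans (size_scale_leq _ _)).
have eX : D *: 'X = l1`_0 *: l2 - l2`_0 *: l1.
  rewrite /D; move: (linE sl1) (linE sl2).
  move: (l1`_0) (l1`_1) (l2`_0) (l2`_1) => x0 x1 y0 y1 -> ->; rewrite -!mul_polyC !(polyCD, polyCN, polyCM); ring.
have e1 : D%:P = l2`_1 *: l1 - l1`_1 *: l2.
  rewrite /D; move: (linE sl1) (linE sl2).
  move: (l1`_0) (l1`_1) (l2`_0) (l2`_1) => x0 x1 y0 y1 -> ->; rewrite -!mul_polyC !(polyCD, polyCN, polyCM); ring.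
exists ((- D^-1 * l2`_0) *: g1 + (D^-1 * l2`_1 * g`_0)%:P),
       ((D^-1 * l1`_0) *: g1 + (- D^-1 * l1`_1 * g`_0)%:P); split.
- by rewrite (leq_trans (size_polyD _ _)) // geq_max sZ s0.
- by rewrite (leq_trans (size_polyD _ _)) // geq_max sZ s0.
have iD : D^-1%:P * D%:P = 1 :> {poly k} by rewrite -polyCM mulVf.
rewrite {1}gE -[g1 * 'X]mul1r -[(g`_0)%:P]mul1r -iD.
have -> : D^-1%:P * D%:P * (g1 * 'X) = D^-1%:P * g1 * (D *: 'X) by rewrite -mul_polyC; ring.
rewrite eX e1 -!mul_polyC !(polyCM, polyCN); ring.
Qed.

(** Induction on the degree: split g as l1 u + l2 v and expand u and v; every term other than the
    pure powers of l1 and l2 contains l1 l2. *)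
Lemma linear_forms_powers n (g : {poly k}) : (0 < n)%N -> (size g <= n.+1)%N ->
  exists c1 c2 (h : {poly k}), (size h <= n.-1)%N /\
    g = c1 *: l1 ^+ n + c2 *: l2 ^+ n + l1 * l2 * h.
Proof.
case: n => // n _; elim: n g => [|n IH] g sg.
  have [u [v [/size1_polyC -> /size1_polyC -> ->]]] := linear_forms_split (ltn0Sn 0) sg.
  exists u`_0, v`_0, 0; rewrite size_poly0 mulr0 addr0 !expr1; split=> //.
  by rewrite ![_ * _%:P]mulrC !mul_polyC.
have [u [v [su sv ->]]] := linear_forms_split (ltn0Sn _) sg.
have [c1 [c2 [h [sh ->]]]] := IH u su; have [e1 [e2 [h' [sh' ->]]]] := IH v sv.
have sX (l : {poly k}) : (size l <= 2)%N -> (size (l ^+ n)%R <= n.+1)%N.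
  move=> sl; have := size_poly_exp_leq l n.
  by move: sl; case: (size l) => [|[|[|]]] //= _; nia.
exists c1, e2, (c2 *: l2 ^+ n + l1 * h + (e1 *: l1 ^+ n + l2 * h')); split; last first.
  by rewrite !exprS -!mul_polyC; ring.
rewrite (leq_trans (size_polyD _ _)) // geq_max.
by rewrite !(leq_trans (size_polyD _ _)) // geq_max (leq_trans (size_scale_leq _ _)) ?sX ?sizeM.
Qed.

(** Hensel lifting: the leading error e is written as l1 u + l2 v, and replacing a, b by a + V, b +
    U cancels it, since V U has higher order. *)
Lemma hensel_quadric s N : ord_ge 2 s -> form s 2 = l1 * l2 ->
  exists a b : S, [/\ ord_ge 1 a, ord_ge 1 b, form a 1 = l1, form b 1 = l2 &
    ord_ge N.+3 (s - a * b)].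
Proof.
move=> hs qs; elim: N => [|N [a [b [ha hb fa fb hab]]]].
  have h1 := ord_ge_hform sl1; have h2 := ord_ge_hform sl2.
  exists (hform 1 l1), (hform 1 l2); rewrite !form_hform //; split=> //.
  apply: ord_geS; first by apply: ord_geB => //; exact: (ord_geM h1 h2).
  by rewrite formB qs (form_mul_lead h1 h2) !form_hform // !eqxx subrr.
have [u [v [su sv e]]] := linear_forms_split (ltn0Sn _) (size_form (s - a * b) N.+3).
have hu := ord_ge_hform su; have hv := ord_ge_hform sv.
set U := hform N.+2 u in hu; set V := hform N.+2 v in hv.
have fU j : form U j = if j == N.+2 then u else 0 by rewrite form_hform.
have fV j : form V j = if j == N.+2 then v else 0 by rewrite form_hform.
exists (a + V), (b + U); split.
- by apply: ord_geD => //; apply: ord_ge_leq hv.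
- by apply: ord_geD => //; apply: ord_ge_leq hu.
- by rewrite formD fV addr0.
- by rewrite formD fU addr0.
have -> : s - (a + V) * (b + U) = (s - a * b) - a * U - b * V - V * U by ring.
have oaU : ord_ge N.+3 (a * U) := ord_geM ha hu.
have obV : ord_ge N.+3 (b * V) := ord_geM hb hv.
have oVU : ord_ge N.+4 (V * U) by apply: ord_ge_leq (ord_geM hv hu); lia.
apply: ord_geB => //; apply: ord_geS; first by do 2!apply: ord_geB => //.
rewrite 2!formB e (form_mul_lead (i := 1) (j := N.+2)) //.
rewrite (form_mul_lead (i := 1) (j := N.+2)) // fa fb fU fV eqxx; ring.
Qed.

End LinearForms.

Section Graded.
Variables (d : nat) (f : dpoly k 2).
Hypotheses (d2 : (2 <= d)%N) (Zf : Z_locus k d f).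
Local Notation mpow := (ideal_pow (@max_ideal (Apolar f))).

Lemma apolar_gr_of_factor s (l1 l2 : {poly k}) : s \in Ann f -> ord_ge 2 s ->
  (size l1 <= 2)%N -> (size l2 <= 2)%N -> l1`_0 * l2`_1 - l1`_1 * l2`_0 != 0 ->
  form s 2 = l1 * l2 -> alg_isomorphic (Apolar f) (gr (Apolar f)).
Proof.
move=> sA hs sl1 sl2 D0 qs; have [hf H] := Zf.
have nz : (1 : Apolar f) <> 0.
  have [_ _ [p [r [pd rd ne]]]] := proj1 (Z_locusP f d2) Zf.
  have [b bd tb] := hankel_top_neq0 (ltnW d2) (top_minor_hankel pd rd ne).
  by rewrite -(rmorph1 (cls f)) => /cls0P h; rewrite (Ann1_top hf h bd) eqxx in tb.
(* With [N = d.-2] the error has order at least d + 1, so it kills f and [a * b] is itself an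
   annihilator. *)
have [a [b [ha hb fa fb hab]]] := hensel_quadric sl1 sl2 D0 d.-2 hs qs.
have abA : a * b \in Ann f.
  have -> : a * b = s - (s - a * b) by ring.
  by apply: rpredB => //; apply: (ord_Ann hf); apply: ord_ge_leq hab; lia.
pose x := cls f a; pose y := cls f b.
have xy : x * y = 0 by rewrite -rmorphM; apply/cls0P.
have xm i : mpow i (x ^+ i).
  apply/(ideal_powP hf nz); exists (a ^+ i); split; first by rewrite rmorphXn.
  by have := ord_geX (n := i) ha; rewrite mul1n.
have ym i : mpow i (y ^+ i).
  apply/(ideal_powP hf nz); exists (b ^+ i); split; first by rewrite rmorphXn.
  by have := ord_geX (n := i) hb; rewrite mul1n.
pose G := powers_span x y.
have Gle i z : G i z -> mpow i z.
  by move=> [c [e ->]]; apply: ideal_powD; exact: ideal_pow_mull.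
have mD z : mpow d.+1 z -> z = 0.
  by move=> /(ideal_powP hf nz) [w [-> hw]]; apply/cls0P/(ord_Ann hf).
have Gspan i z : mpow i z -> exists2 z', G i z' & mpow i.+1 (z - z').
  move=> /(ideal_powP hf nz) [w [-> hw]]; case: i hw => [|i] hw.
    exists (algmap (form w 0)`_0); first by exists (form w 0)`_0, 0; rewrite algmap0 mul0r addr0 mulr1.
    rewrite -cls_const -rmorphB; apply/(ideal_powP hf nz); eexists; split; first reflexivity.
    by move=> [|//] _; rewrite formB form_const /= -size1_polyC ?subrr // size_form.
  have [c1 [c2 [h [sh e]]]] := linear_forms_powers sl1 sl2 D0 (ltn0Sn i) (size_form w i.+1).
  have oa := ord_geX (n := i.+1) ha; have ob := ord_geX (n := i.+1) hb.
  have ga := form_expX i.+1 ha; have gb := form_expX i.+1 hb.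
  rewrite mul1n in oa ga; rewrite mul1n in ob gb; rewrite fa in ga; rewrite fb in gb.
  have [t [tA ot ft]] : exists t, [/\ t \in Ann f, ord_ge i.+1 t & form t i.+1 = l1 * l2 * h].
    case: i {hw} sh e oa ob ga gb => [|i] sh _ _ _ _ _.
      exists 0; split; [by apply/cls0P; rewrite rmorph0|exact: ord_ge0|].
      by rewrite form0; move: sh; rewrite leqn0 size_poly_eq0 => /eqP ->; rewrite mulr0.
    have hh := ord_ge_hform sh.
    exists (hform i h * (a * b)); split; first exact: ideal_mulr.
      by have := ord_geM hh (ord_geM ha hb); rewrite addn2.
    have := form_mul_lead hh (ord_geM ha hb); rewrite addn2 => ->.
    by rewrite (form_mul_lead ha hb) fa fb form_hform // eqxx mulrC.
  exists (algmap c1 * x ^+ i.+1 + algmap c2 * y ^+ i.+1); first by exists c1, c2.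
  rewrite -!cls_const -!rmorphXn -!rmorphM -rmorphD -rmorphB; apply/(ideal_pow_cls hf nz).
  exists (w - (cst c1 * a ^+ i.+1 + cst c2 * b ^+ i.+1) - t); rewrite opprB addrC subrK; split=> //.
  apply: ord_geS.
    by do 2!apply: ord_geB => //; apply: ord_geD; exact: ord_ge_constM.
  by rewrite !formB formD !form_constM ga gb ft e; ring.
(* For i < d the generators span a quotient whose dimension, 1 for i = 0 and 2 otherwise, is the
   number of generators used, so they are a basis. For i >= d, m^(i+1) is already zero. *)
have Gfree i z : G i z -> mpow i.+1 z -> z = 0.
  move=> [c1 [c2 ->]] hz; have [i0|i0] := posnP i.
    have h0 : dim_quot (mpow 0) (mpow 1) 1 := H 0%N.
    have cE (c : 'I_1 -> k) : \sum_l algmap (c l) * (1 : Apolar f) = algmap (c ord0).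
      by rewrite big_ord_recl big_ord0 addr0 mulr1.
    move: hz; rewrite i0 !mulr1 -algmapD => hz.
    have c0 : \row_(l < 1) (c1 + c2) = 0.
      apply: (dim_quot_span_free (g := fun=> 1) h0) => // [z' /Gspan [_ [e1 [e2 ->]]]|].
        by rewrite !mulr1 -algmapD => h; exists (fun=> e1 + e2); rewrite cE.
      by rewrite cE mxE.
    by have /rowP /(_ ord0) := c0; rewrite !mxE => ->; rewrite algmap0.
  have [di|id] := leqP d i; first by apply: mD; apply: ideal_pow_leq hz.
  have h2 : nth 0%N (1 :: rcons (nseq d.-1 2) 1)%N i = 2%N.
    by case: i i0 id {hz} => // i _ id; rewrite /= nth_rcons size_nseq nth_nseq !ifT //; lia.
  have := H i; rewrite h2 => Hi.
  pose g (l : 'I_2) := if l == ord0 then x ^+ i else y ^+ i.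
  have cE (c : 'I_2 -> k) : \sum_l algmap (c l) * g l = algmap (c ord0) * x ^+ i + algmap (c ord_max) * y ^+ i.
    exact: comb2.
  have /rowP c0 : \row_(l < 2) (if l == ord0 then c1 else c2) = 0.
    apply: (dim_quot_span_free (g := g) Hi) => [l|z' /Gspan [_ [e1 [e2 ->]] h]|].
    - by rewrite /g; case: ifP.
    - by exists (fun l => if l == ord0 then e1 else e2); rewrite cE.
    by rewrite cE !mxE.
  have := c0 ord0; have := c0 ord_max; rewrite !mxE /= => -> ->.
  by rewrite !algmap0 !mul0r addr0.
apply: (@split_filtration_gr _ _ d.+1 G) => //.
- by rewrite -(algmap1 (s := Apolar f)); exact: powers_span_const.
- by move=> c; exact: powers_span_const.
- by move=> i z z'; exact: powers_spanB.
by move=> i j z z'; exact: powers_spanM.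
Qed.

End Graded.
End Distinct.

(** * The discriminant condition that defines the open set *)

Section GeneralElement.
Variables (k : closedFieldType) (d : nat).
Local Notation n := (affine_dim d).

Lemma quadric_factor (r : {poly k}) : (size r <= 3)%N ->
  r`_1 ^+ 2 - r`_0 * r`_2 *+ 4 != 0 ->
  exists l1 l2 : {poly k}, [/\ (size l1 <= 2)%N, (size l2 <= 2)%N,
    l1`_0 * l2`_1 - l1`_1 * l2`_0 != 0 & r = l1 * l2].
Proof.
move=> sr D.
have rE : r = (r`_0)%:P + (r`_1)%:P * 'X + (r`_2)%:P * 'X ^+ 2.
  apply/polyP => -[|[|[|i]]]; rewrite !coefD coefC coefMX coefCM coefXn /= ?coefC ?mulr1 ?mulr0 ?addr0 ?add0r //.
  by rewrite nth_default // (leq_trans sr).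
have sl (a b : k) : (size (a%:P + b%:P * 'X)%R <= 2)%N.
  rewrite (leq_trans (size_polyD _ _)) // geq_max (leq_trans (size_polyC_leq1 _)) //=.
  by rewrite mul_polyC (leq_trans (size_scale_leq _ _)) // size_polyX.
have c0 (a b : k) : (a%:P + b%:P * 'X)`_0 = a by rewrite coefD coefC coefMX addr0.
have c1 (a b : k) : (a%:P + b%:P * 'X)`_1 = b by rewrite coefD coefC coefMX coefC add0r.
have [r2|r2] := eqVneq r`_2 0.
  (* The root lies at infinity: the first factor is the linear form beta, which dehomogenises to
     1. *)
  exists (1%:P + 0%:P * 'X), ((r`_0)%:P + (r`_1)%:P * 'X); rewrite !c0 !c1; split=> //.
    by apply: contraNneq D; rewrite mul1r mul0r subr0 r2 mulr0 mul0rn subr0 => ->; rewrite expr0n.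
  by rewrite {1}rE r2 !polyC0 !mul0r !addr0 mul1r.
have [x xr] : exists x, r`_0 + r`_1 * x + r`_2 * x ^+ 2 = 0.
  have : size r != 1%N.
    apply: contraNneq r2 => s1; by rewrite nth_default // s1.
  move=> /closed_rootP [x /rootP rx]; exists x.
  by transitivity r.[x] => //; rewrite [in RHS]rE !hornerE; ring.
have r0 : r`_0 = - (r`_1 * x + r`_2 * (x * x)).
  by apply/eqP; rewrite -addr_eq0 addrA -expr2 xr.
exists ((- x)%:P + 1%:P * 'X), ((r`_1 + r`_2 * x)%:P + (r`_2)%:P * 'X); rewrite !c0 !c1; split=> //.
  apply: contraNneq D => e.
  have -> : r`_1 ^+ 2 - r`_0 * r`_2 *+ 4 = (- x * r`_2 - 1 * (r`_1 + r`_2 * x)) ^+ 2.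
    by rewrite r0; ring.
  by rewrite e expr0n.
by rewrite {1}rE r0 !(polyCD, polyCN, polyCM, polyC1); ring.
Qed.

(* The discriminant of the quadric apolar to both linear conditions x and y: *)
(* its coefficient vector is the cross product of x and y.                   *)
Definition cross_disc (R : comNzRingType) (x0 x1 x2 y0 y1 y2 : R) : R :=
  (x2 * y0 - x0 * y2) ^+ 2 - ((x1 * y2 - x2 * y1) * (x0 * y1 - x1 * y0)) *+ 4.

(** A vector r orthogonal to x and y is proportional to their cross product q. As the discriminant
    is homogeneous of degree two, r_i^2 disc(q) = q_i^2 disc(r) = 0 for each i. *)
Lemma cross_disc_orthogonal (x0 x1 x2 y0 y1 y2 r0 r1 r2 : k) :
  cross_disc x0 x1 x2 y0 y1 y2 != 0 ->
  r0 * x0 + r1 * x1 + r2 * x2 = 0 -> r0 * y0 + r1 * y1 + r2 * y2 = 0 ->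
  r1 ^+ 2 - r0 * r2 *+ 4 = 0 -> [/\ r0 = 0, r1 = 0 & r2 = 0].
Proof.
move=> D hx hy dr.
set q0 := x1 * y2 - x2 * y1; set q1 := x2 * y0 - x0 * y2; set q2 := x0 * y1 - x1 * y0.
have e01 : r0 * q1 = r1 * q0.
  apply/eqP; rewrite -subr_eq0; apply/eqP.
  transitivity (x2 * (r0 * y0 + r1 * y1 + r2 * y2) - y2 * (r0 * x0 + r1 * x1 + r2 * x2)).
    by rewrite /q0 /q1; ring.
  by rewrite hx hy; ring.
have e02 : r0 * q2 = r2 * q0.
  apply/eqP; rewrite -subr_eq0; apply/eqP.
  transitivity (y1 * (r0 * x0 + r1 * x1 + r2 * x2) - x1 * (r0 * y0 + r1 * y1 + r2 * y2)).
    by rewrite /q0 /q2; ring.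
  by rewrite hx hy; ring.
have e12 : r1 * q2 = r2 * q1.
  apply/eqP; rewrite -subr_eq0; apply/eqP.
  transitivity (x0 * (r0 * y0 + r1 * y1 + r2 * y2) - y0 * (r0 * x0 + r1 * x1 + r2 * x2)).
    by rewrite /q1 /q2; ring.
  by rewrite hx hy; ring.
have DE : cross_disc x0 x1 x2 y0 y1 y2 = q1 ^+ 2 - q0 * q2 *+ 4 by [].
have K r q : r ^+ 2 * cross_disc x0 x1 x2 y0 y1 y2 = q ^+ 2 * (r1 ^+ 2 - r0 * r2 *+ 4) -> r = 0.
  by rewrite dr mulr0 => /eqP; rewrite mulf_eq0 (negbTE D) orbF expf_eq0 => /eqP.
split.
- apply: (K _ q0); rewrite DE.
  transitivity ((r0 * q1) ^+ 2 - q0 * r0 * (r0 * q2) *+ 4); first by ring.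
  by rewrite e01 e02; ring.
- apply: (K _ q1); rewrite DE.
  transitivity (r1 ^+ 2 * q1 ^+ 2 - (r1 * q0) * (r1 * q2) *+ 4); first by ring.
  by rewrite -e01 e12; ring.
apply: (K _ q2); rewrite DE.
transitivity ((r2 * q1) ^+ 2 - q2 * r2 * (r2 * q0) *+ 4); first by ring.
by rewrite -e12 -e02; ring.
Qed.

Definition ctop a : {mpoly k[n]} := coord k d (mon a (d - a)).

(* The quadratic part of Ann(f) is determined by the first and last rows of the *)
(* catalecticant of the top form; for d = 2 there is one row only, and any      *)
(* second condition picks a quadric in Ann(f).                                  *)
Definition row2 (R : nzRingType) (c : nat -> R) (i : nat) : R :=
  if d == 2%N then (i == 2%N)%:R else c (d - 2 + i)%N.

Definition disc_of (R : comNzRingType) (c : nat -> R) : R :=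
  cross_disc (c 0%N) (c 1%N) (c 2%N) (row2 c 0) (row2 c 1) (row2 c 2).

Lemma disc_ofE f : (2 <= d)%N -> (disc_of ctop).@[dp_coords f] = disc_of (top d f).
Proof.
move=> d2.
have E a : (a <= d)%N -> (ctop a).@[dp_coords f] = top d f a.
  by move=> ad; rewrite coordE // mdeg_mon subnKC.
have E2 i : (i <= 2)%N -> (row2 ctop i).@[dp_coords f] = row2 (top d f) i.
  move=> i2; rewrite /row2; case: eqP => _; first by rewrite rmorph_nat.
  by apply: E; lia.
rewrite /disc_of /cross_disc.
by rewrite !(rmorphB, rmorphM, rmorphXn, rmorphMn) /= !(E, E2) //; lia.
Qed.

Lemma lam_quadric f (r : {poly k}) p : (size r <= 3)%N -> (p + 2 <= d)%N ->
  lam d f (r * 'X^p) = r`_0 * top d f p + r`_1 * top d f (p + 1) + r`_2 * top d f (p + 2).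
Proof.
move=> sr pd.
have rE : r = r`_0 *: 1 + r`_1 *: 'X^1 + r`_2 *: 'X^2.
  apply/polyP => -[|[|[|i]]]; rewrite !coefD !coefZ coef1 !coefXn /= ?mulr1 ?mulr0 ?addr0 ?add0r //.
  by rewrite nth_default // (leq_trans sr).
rewrite {1}rE !mulrDl -!scalerAl !lamD !lamZ mul1r -!exprD !(addnC _ p).
by rewrite !lamXn //; lia.
Qed.

Lemma general_order2_Ann f : (2 <= d)%N -> Z_locus k d f -> disc_of (top d f) != 0 ->
  exists s, [/\ s \in Ann f, ord_ge 2 s &
    (form s 2)`_1 ^+ 2 - (form s 2)`_0 * (form s 2)`_2 *+ 4 != 0].
Proof.
move=> d2 /(Z_locusP f d2)[hf [s [sA hs s0]] _] D.
have [d3|dn] := eqVneq d 2%N.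
  pose x i := top d f i.
  (* The cross product of (x_0, x_1, x_2) and the auxiliary vector (0, 0, 1). It is orthogonal to
     the top form, which for d = 2 suffices to kill f. *)
  pose r : {poly k} := (x 1%N)%:P - (x 0%N)%:P * 'X.
  have c0 : r`_0 = x 1%N by rewrite coefB coefC coefMX subr0.
  have c1 : r`_1 = - x 0%N by rewrite coefB coefC coefMX coefC sub0r.
  have c2 : r`_2 = 0 by rewrite coefB coefC coefMX coefC subr0.
  have sr : (size r <= 3)%N.
    apply/leq_sizeP => -[|[|[|j]]] // _.
    by rewrite coefB coefC coefMX coefC subr0.
  have hr := ord_ge_hform sr.
  exists (hform 2 r); rewrite form_hform // eqxx c0 c1 c2; split=> //.
    apply: (lam_Ann hf); first by rewrite {1}d3.
    rewrite {2}d3 form_hform // eqxx -[r]mulr1 -(expr0 'X) lam_quadric ?add0n //.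
    by rewrite c0 c1 c2 -/(x 0%N) -/(x 1%N); ring.
  have dt : (d == 2%N) = true by apply/eqP.
  move: D; rewrite /disc_of /row2 dt /cross_disc /= -/(x 0%N) -/(x 1%N) -/(x 2%N).
  by apply: contraNneq => e; apply/eqP; rewrite -[RHS]e; ring.
exists s; split=> //; apply: contraNneq s0 => dr.
have sr : (size (form s 2) <= 3)%N := size_form s 2.
have h1 := Ann_lam hf sA hs (p := 0%N) ltac:(lia).
have h2 := Ann_lam hf sA hs (p := (d - 2)%N) ltac:(lia).
rewrite lam_quadric // ?add0n // in h1; rewrite lam_quadric // ?subnK // in h2.
move: D; rewrite /disc_of /row2 (negbTE dn) addn0 subnK // => D.
have [e0 e1 e2] := cross_disc_orthogonal D h1 h2 dr.
apply/eqP/polyP => -[|[|[|i]]]; rewrite coef0 //.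
by rewrite nth_default // (leq_trans sr).
Qed.

(** The two conditions are (1, 0, c_2) and (0, 0, 1), with cross product (0, -1, 0): up to sign the
    quadric alpha beta, of discriminant 1. *)
Lemma disc_fermat : (2 <= d)%N -> disc_of (top d (fermat k d)) != 0.
Proof.
move=> d2; have T a := @top_fermat k d a (ltnW d2).
have [r0 r1 r2] : [/\ row2 (top d (fermat k d)) 0 = 0, row2 (top d (fermat k d)) 1 = 0 &
    row2 (top d (fermat k d)) 2 = 1].
  rewrite /row2; case: eqP => // dn; rewrite !T; try lia.
  rewrite subnK // eqxx orbT; split=> //.
    by rewrite (_ : _ || _ = false) //; lia.
  by rewrite (_ : _ || _ = false) //; lia.
rewrite /disc_of /cross_disc r0 r1 r2 !T; try lia.
rewrite (_ : (1 == d)%N = false) /=; last lia.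
by rewrite !(mulr0, mul0r, mul1r, subr0, sub0r, mul0rn, sqrrN, expr1n) oner_eq0.
Qed.

End GeneralElement.

Local Open Scope classical_set_scope.

Theorem mainTheorem4 (k : closedFieldType) (d : nat) (hd : (2 <= d)%N)
    (hchar : forall p : nat, p \in [pchar k] -> (d < p)%N) :
  zariski_irreducible d (Z_locus k d) /\
  exists U : set (dpoly k 2),
    [/\ zariski_open_in d (Z_locus k d) U,
        U !=set0 &
        forall f : dpoly k 2, U f ->
          alg_isomorphic (Apolar f) (gr (Apolar f))].
Proof.
have Zne := Z_locus_fermat k hd.
split; first by apply: Z_locus_irreducible => //; exists (fermat k d).
pose V : set (dpoly k 2) := P_le k d `&`
  [set f | forall p, [set disc_of d (ctop k d)] p -> p.@[dp_coords f] = 0].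
exists (Z_locus k d `\` V); split.
- by exists V; split=> //; exists [set disc_of d (ctop k d)].
- exists (fermat k d); split=> // -[_ /(_ _ erefl)] /eqP; rewrite disc_ofE //.
  exact/negP/disc_fermat.
move=> f [Zf nV].
have D : disc_of d (top d f) != 0.
  apply/eqP => e; apply: nV; split; first by case: Zf.
  by move=> _ ->; rewrite disc_ofE.
have [s [sA hs sD]] := general_order2_Ann hd Zf D.
have [l1 [l2 [sl1 sl2 lD qs]]] := quadric_factor (size_form s 2) sD.
exact: (apolar_gr_of_factor hd Zf sA hs sl1 sl2 lD qs).
Qed.
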